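(* For every $\varepsilon>0$ there is an integer $M=M(\varepsilon)\ge1$, not depending on $n$, such that for every even $n\ge2$ there is a map $K_n$, assigning to each graph on the vertex set $[n]$ a subset of $[n]$ of size at most $M$, with the following property. Let $G$ be a uniformly random perfect matching of the complete graph on $[n]$, independent of the uniform random recursive tree $\mathcal T_n$. Then $$\mathbb P\big(\pi_n(1)\in K_n(\pi_n(\mathcal T_n(G)))\big)\ \ge\ 1-\varepsilon .$$ (That is, observing $\mathcal T_n(G)$ without its vertex labels, one can construct a confidence set, of size not depending on $n$, that contains the root vertex $1$ with probability at least $1-\varepsilon$.)
   Context: $[n]=\{1,\dots,n\}$. Uniform random recursive tree: $\mathcal T_1$ is the single vertex $1$; for $i\ge1$, given $\mathcal T_i$, the tree $\mathcal T_{i+1}$ is obtained by adding vertex $i+1$ and joining it by an edge to a vertex chosen uniformly at random from $\{1,\dots,i\}$. Thus $\mathcal T_n$ is a random tree on $[n]$ with root $1$. Noisy recursive tree: for a graph $G$ on $[n]$, $\mathcal T_n(G)=\mathcal T_n\cup G$ is the (simple) graph on $[n]$ in which two vertices are adjacent if and only if they are adjacent in $\mathcal T_n$ or in $G$. Observation without labels: $\pi_n$ is a uniformly random permutation of $[n]$ independent of everything else, and for a graph $F$ on $[n]$, $\pi_n(F)$ is the graph on $[n]$ with edges $\{\pi_n(u),\pi_n(v)\}$, $\{u,v\}\in E(F)$. *)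

(* Defs.v *)
From HB Require Import structures.
From mathcomp Require Import all_boot all_order all_algebra all_fingroup.
From mathcomp Require Import reals.

Set Implicit Arguments.
Unset Strict Implicit.
Unset Printing Implicit Defensive.

Import GRing.Theory Num.Theory.
Local Open Scope ring_scope.

(* The vertex set [n] is 'I_n: the vertex labelled i in {1, ..., n} is the
   ordinal of value i - 1, so that the root 1 is the ordinal 0. *)

Record sgraph (n : nat) := SGraph {
  edges :> {set {set 'I_n}};
  edges_card2 : [forall e in edges, #|e| == 2%N]
}.

HB.instance Definition _ (n : nat) := [isSub for @edges n].
HB.instance Definition _ (n : nat) := [Finite of sgraph n by <:].

Section Graphs.
Variable n : nat.
Implicit Types F G : sgraph n.

Lemma card_edge F e : e \in edges F -> #|e| = 2%N.
Proof. by move=> eF; apply/eqP; have /forall_inP := edges_card2 F; apply. Qed.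

Lemma gunion_subproof F G : [forall e in edges F :|: edges G, #|e| == 2%N].
Proof.
by apply/forall_inP => e; rewrite inE => /orP[] /card_edge ->.
Qed.

Definition gunion F G : sgraph n := SGraph (gunion_subproof F G).

Lemma relabel_subproof (p : {perm 'I_n}) F :
  [forall e in [set [set p x | x in e] | e : {set 'I_n} in edges F],
    #|e| == 2%N].
Proof.
apply/forall_inP => _ /imsetP[e eF ->].
by rewrite card_imset ?(card_edge eF)//; exact: perm_inj.
Qed.

Definition relabel (p : {perm 'I_n}) F : sgraph n :=
  SGraph (relabel_subproof p F).

Definition perfect_matchings : {set sgraph n} :=
  [set F : sgraph n | [forall v, #|[set e in edges F | v \in e]| == 1%N]].

Lemma attach_subproof F (j : 'I_n) :
  [forall e in [set ord_max; widen_ord (leqnSn n) j]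
      |: [set [set widen_ord (leqnSn n) x | x in e]
             | e : {set 'I_n} in edges F], #|e| == 2%N].
Proof.
apply/forall_inP => e; rewrite !inE => /orP[/eqP->|/imsetP[f fF ->]].
  by rewrite cards2 -val_eqE /= (gtn_eqF (ltn_ord j)).
rewrite card_imset ?(card_edge fF)// => x y /(congr1 val) /= xy.
exact: val_inj.
Qed.

(* F together with the new vertex ord_max, joined to the vertex j of F. *)
Definition attach F (j : 'I_n) : sgraph n.+1 := SGraph (attach_subproof F j).

End Graphs.

Section FiniteProbability.
Variable R : numFieldType.

Definition uniform_law (T : finType) (A : {set T}) (x : T) : R :=
  (x \in A)%:R / #|A|%:R.

Definition product_law (S T : finType) (mu : S -> R) (nu : T -> R)
  (x : S * T) : R := mu x.1 * nu x.2.

Definition Pr (T : finType) (mu : T -> R) (A : pred T) : R :=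
  \sum_(x | A x) mu x.

(* Probability mass function of the uniform random recursive tree on n
   vertices. There is no such tree for n = 0; that value is a dummy. *)
Fixpoint rrt_law (n : nat) : sgraph n -> R :=
  match n return sgraph n -> R with
  | 0 => fun=> 0
  | i.+1 => fun F' =>
      if i == 0%N then (edges F' == set0)%:R
      else \sum_(F : sgraph i) rrt_law F
             * \sum_(j : 'I_i) uniform_law [set: 'I_i] j * (F' == attach F j)%:R
  end.

End FiniteProbability.

(* Main.v *)
(* The estimator. In the noisy tree F = T + G let S be the set of vertices of
   degree at least d2, close to log2 n, and let the hubs be the vertices of S and
   the vertices of degree at least d1 = (4/9) d2 that have two neighbours of
   degree at least d1. A vertex v is a candidate when deleting v from the graph
   induced on the hubs splits S into two sides that both carry a constant
   proportion of S; this does not involve labels.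

   Why it works. An edge of T inside the hubs is an edge of F, and with high
   probability no edge of G joins two hubs, as there are far fewer than sqrt n of
   them. So the graph of hubs is a forest of T-edges. The subtree of the second
   vertex and its complement both contain a constant proportion of S (Polya urn
   up to a large constant time m, then a second moment bound), hence the root is
   a candidate. Conversely almost every vertex of S has only ancestors of degree
   at least d1, so it is joined to the root through hubs; deleting v can then only
   cut off vertices of S lying below v, and v is a candidate only if the number W_v
   of those is at least a constant times |S|. As the expectation of sum_v W_v^2 =
   sum_(u, u' in S) #(common ancestors of u and u') is O(|S|^2), there are O(1)
   such vertices.

   The moments come from one fact: the expected number of vertices, or of pairs of
   vertices, with prescribed positions in the tree drops by a factor of at least
   2^k for each vertex that is required to have at least k children. *)

Require Import Defs.
From mathcomp Require Import all_boot all_order all_algebra all_fingroup.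
From mathcomp Require Import reals.
From mathcomp Require Import zify ring lra.

Set Implicit Arguments.
Unset Strict Implicit.
Unset Printing Implicit Defensive.

Import Order.TTheory GRing.Theory Num.Theory.
Local Open Scope ring_scope.

(** * Expectations over a growing tree *)

(* [s] lists the parents of the vertices [m, m + 1, ...], most recent first. *)
Fixpoint valid (m : nat) (s : seq nat) : bool :=
  if s is j :: s' then (j < m + size s')%N && valid m s' else true.

Section Expectation.
Variable R : realFieldType.
Implicit Types (m q : nat) (f g : seq nat -> R) (s : seq nat).

(* Expectation over the growth of a tree from [m] to [m + q] vertices. *)
Fixpoint Ex m q f : R :=
  if q is q'.+1
  then Ex m q' (fun s => (\sum_(j < m + q') f (nat_of_ord j :: s)) / (m + q')%:R)
  else f [::].

Lemma Ex_le m q f g :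
  (forall s, valid m s -> size s = q -> f s <= g s) -> Ex m q f <= Ex m q g.
Proof.
elim: q f g => [|q IH] f g fg /=; first exact: fg.
apply: IH => s vs sq; rewrite ler_wpM2r ?invr_ge0//; apply: ler_sum => j _.
by apply: fg; rewrite /= ?sq // ltn_ord.
Qed.

Lemma eq_Ex m q f g :
  (forall s, valid m s -> size s = q -> f s = g s) -> Ex m q f = Ex m q g.
Proof.
by move=> fg; apply/eqP; rewrite eq_le !Ex_le // => s vs sq; rewrite fg.
Qed.

Lemma ExD m q f g : Ex m q (fun s => f s + g s) = Ex m q f + Ex m q g.
Proof.
elim: q f g => [//|q IH] f g /=; rewrite -IH; apply: eq_Ex => s _ _.
by rewrite big_split mulrDl.
Qed.

Lemma ExZ m q c f : Ex m q (fun s => c * f s) = c * Ex m q f.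
Proof.
elim: q f => [//|q IH] f /=; rewrite -IH; apply: eq_Ex => s _ _.
by rewrite -mulr_sumr mulrA.
Qed.

Lemma ExB m q f g : Ex m q (fun s => f s - g s) = Ex m q f - Ex m q g.
Proof.
rewrite ExD -mulN1r -ExZ; congr (_ + _).
by apply: eq_Ex => s _ _; rewrite mulN1r.
Qed.

Lemma Ex_cst m q c : (0 < m)%N -> Ex m q (fun=> c) = c.
Proof.
move=> m_gt0; elim: q => [//|q IH] /=; rewrite -[RHS]IH; apply: eq_Ex => s _ _.
rewrite sumr_const card_ord -[c *+ _]mulr_natr mulfK // pnatr_eq0; lia.
Qed.

Lemma Ex_ge0 m q f :
  (forall s, valid m s -> size s = q -> 0 <= f s) -> 0 <= Ex m q f.
Proof.
move=> f0; rewrite -[X in X <= _](mul0r (Ex m q (fun=> 0))) -ExZ.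
by apply: Ex_le => s vs sq; rewrite mul0r f0.
Qed.

(** Conditioning on the tree at time [m + q]. The later history [s] stands in front of [t], parents
    being listed most recent first. *)
Lemma Ex_cat m q q' f :
  Ex m (q + q') f = Ex m q (fun t => Ex (m + q) q' (fun s => f (s ++ t))).
Proof.
elim: q' f => [|q' IH] f; first by rewrite addn0; apply: eq_Ex.
by rewrite addnS /= IH; apply: eq_Ex => t _ _; rewrite addnA.
Qed.

End Expectation.

(** Multiplying by the current number of vertices gives the recursions below without
    denominators. *)
Lemma ExS (R : realFieldType) m q (f : seq nat -> R) : (0 < m)%N ->
  (m + q)%:R * Ex m q.+1 f
  = Ex m q (fun s => \sum_(j < m + q) f (nat_of_ord j :: s)).
Proof.
move=> m0 /=; rewrite -ExZ; apply: eq_Ex => s _ _.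
by rewrite mulrC divfK // pnatr_eq0; lia.
Qed.

(** Only attachments recorded in [s] count; edges inside the initial tree on [m] vertices are
    ignored. *)
Definition children (s : seq nat) (u : nat) : nat := count_mem u s.
Arguments children : simpl never.

Lemma children_cons j s u :
  children (j :: s) u = ((j == u) + children s u)%N.
Proof. by []. Qed.

Lemma children_new m s u : valid m s -> (m + size s <= u)%N -> children s u = 0%N.
Proof.
elim: s => [//|j s IH] /= /andP[jm vs] su.
by rewrite children_cons IH //; [case: eqVneq => // ?; lia|lia].
Qed.

Section Sums.
Variable R : realFieldType.

Lemma sum_pick n u (g : nat -> R) : (u < n)%N ->
  \sum_(j < n) (nat_of_ord j == u)%:R * g j = g u.
Proof.
move=> un; rewrite (bigD1 (Ordinal un)) //= eqxx mul1r big1 ?addr0 // => j.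
by rewrite -val_eqE /= => /negPf ->; rewrite mul0r.
Qed.

(** Among [n] equally likely parents exactly one raises the count at [u]. *)
Lemma sum_bump n u (c : nat) (g : nat -> R) : (u < n)%N ->
  \sum_(j < n) g ((nat_of_ord j == u) + c)%N = (n%:R - 1) * g c + g c.+1.
Proof.
move=> un; under eq_bigr => j _.
  rewrite (_ : g _ = g c + (nat_of_ord j == u)%:R * (g c.+1 - g c)); last first.
    by case: (_ == u); rewrite ?mul1r ?mul0r ?addr0 // addrCA subrr addr0.
  over.
rewrite big_split /= (sum_pick (fun=> g c.+1 - g c) un) sumr_const card_ord.
by rewrite -mulr_natl; ring.
Qed.

(** A new vertex has one parent, so no choice raises the counts at two different vertices. This is
    why pairs are kept apart from the diagonal below. *)
Lemma sum_bump2 n u u' (c c' : nat) (h : nat -> nat -> R) :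
  (u < n)%N -> (u' < n)%N -> u != u' ->
  \sum_(j < n) h ((nat_of_ord j == u) + c)%N ((nat_of_ord j == u') + c')%N
  = (n%:R - 2) * h c c' + h c.+1 c' + h c c'.+1.
Proof.
move=> un un' uu'; under eq_bigr => j _.
  rewrite (_ : h _ _ = h c c' + (nat_of_ord j == u)%:R * (h c.+1 c' - h c c')
            + (nat_of_ord j == u')%:R * (h c c'.+1 - h c c')); last first.
    case: (eqVneq (nat_of_ord j) u) => [->|_].
      by rewrite (negPf uu') /= add1n add0n mul1r mul0r addr0 addrCA subrr addr0.
    rewrite mul0r addr0.
    by case: (_ == u'); rewrite ?mul1r ?mul0r ?addr0 // addrCA subrr addr0.
  over.
rewrite !big_split /= (sum_pick (fun=> h c.+1 c' - h c c') un).
rewrite (sum_pick (fun=> h c c'.+1 - h c c') un') sumr_const card_ord.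
by rewrite -mulr_natl; ring.
Qed.

End Sums.

(** * Thresholds on the number of children *)

(* A new vertex relates to the others as its parent does; [gam] accounts for the
   new vertex being its own ancestor. The kernels used are the constant one, the
   number of common ancestors, and the indicator that both vertices descend from a
   given set of initial vertices. *)
Section Kernels.
Variables (R : realFieldType) (m : nat) (gam : R).
Variable B : seq nat -> nat -> nat -> R.
Hypothesis m_gt0 : (0 < m)%N.
Hypothesis gam_ge0 : 0 <= gam.
Hypothesis B_ge0 : forall s u v, 0 <= B s u v.
Hypothesis B_old : forall s j u v, valid m (j :: s) -> (u < m + size s)%N -> (v < m + size s)%N ->
  B (j :: s) u v = B s u v.
Hypothesis B_newl : forall s j u, valid m (j :: s) -> (u < m + size s)%N ->
  B (j :: s) (m + size s)%N u = B s j u.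
Hypothesis B_newr : forall s j u, valid m (j :: s) -> (u < m + size s)%N ->
  B (j :: s) u (m + size s)%N = B s u j.
Hypothesis B_new : forall s j, valid m (j :: s) ->
  B (j :: s) (m + size s)%N (m + size s)%N = B s j j + gam.

Definition diag (g : nat -> R) s : R :=
  \sum_(u < m + size s) B s u u * g (children s u).

Definition offdiag (h : nat -> nat -> R) s : R :=
  \sum_(u < m + size s) \sum_(v < m + size s)
    (u != v :> nat)%:R * (B s u v * h (children s u) (children s v)).

(** Old vertices evolve by [sum_bump]. The new vertex has no children and inherits the kernel value
    of its uniform parent, up to [gam]; this is the last summand. *)
Lemma diag_step g s : valid m s ->
  \sum_(j < m + size s) diag g (nat_of_ord j :: s)
  = ((m + size s)%:R - 1) * diag g s + diag (g \o succn) s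
    + g 0%N * (diag (fun=> 1) s + (m + size s)%:R * gam).
Proof.
move=> vs; have vjs (j : 'I_(m + size s)) : valid m (nat_of_ord j :: s).
  by rewrite /= ltn_ord.
rewrite /diag /= addnS.
under eq_bigr => j _ do
  rewrite big_ord_recr /= (B_new (vjs j)) children_cons (children_new vs) //.
rewrite big_split /= exchange_big /=; congr (_ + _).
  rewrite mulr_sumr -big_split /=; apply: eq_bigr => u _.
  under eq_bigr => j _ do rewrite (B_old (vjs j)) //.
  rewrite -mulr_sumr; under eq_bigr => j _ do rewrite children_cons.
  by rewrite (sum_bump _ _ (ltn_ord u)) /=; ring.
under eq_bigr => j _ do rewrite (ltn_eqF (ltn_ord j)) mulrC.
rewrite -mulr_sumr big_split /= sumr_const card_ord mulr_natl.
by congr (_ * (_ + _)); apply: eq_bigr => u _; rewrite mulr1.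
Qed.

(** Pairs of old vertices evolve by [sum_bump2]. A pair of the new vertex and an old [u] has the
    kernel value of [u] and the parent [j]: an off-diagonal term if [j] differs from [u], a diagonal
    one with one more child if [j] is [u]. *)
Lemma offdiag_step h s : valid m s ->
  \sum_(j < m + size s) offdiag h (nat_of_ord j :: s)
  = ((m + size s)%:R - 2) * offdiag h s
    + offdiag (fun a b => h a.+1 b) s + offdiag (fun a b => h a b.+1) s
    + (offdiag (fun a b => h a 0%N) s + diag (fun a => h a.+1 0%N) s)
    + (offdiag (fun a b => h 0%N b) s + diag (fun b => h 0%N b.+1) s).
Proof.
move=> vs; rewrite /offdiag /diag /= addnS; set n := (m + size s)%N.
have vjs (j : 'I_n) : valid m (nat_of_ord j :: s) by rewrite /= ltn_ord.
have new_pairs g (b : nat -> nat -> R) : \sum_(j < n) \sum_(u < n)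
      b u j * g ((nat_of_ord j == u) + children s u)%N
    = \sum_(u < n) \sum_(v < n) (u != v :> nat)%:R * (b u v * g (children s u))
      + \sum_(u < n) b u u * g (children s u).+1.
  rewrite exchange_big -big_split /=; apply: eq_bigr => u _.
  rewrite -(sum_pick (fun v => b u v * g (children s u).+1) (ltn_ord u)) -big_split /=.
  by apply: eq_bigr => v _; rewrite eq_sym; case: eqVneq => _;
    rewrite ?mul1r ?mul0r ?add0r ?addr0.
under eq_bigr => j _.
  rewrite big_ord_recr /=.
  rewrite [X in _ + X]big_ord_recr /= eqxx mul0r addr0.
  under [X in _ + X]eq_bigr => v _.
    rewrite (gtn_eqF (ltn_ord v)) mul1r (B_newl (vjs j)) //.
    rewrite children_cons (children_new vs) // -/n (ltn_eqF (ltn_ord j)) addn0.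
    over.
  under eq_bigr => u _.
    rewrite big_ord_recr /= (ltn_eqF (ltn_ord u)) mul1r (B_newr (vjs j)) //.
    rewrite [X in h _ X]children_cons (children_new vs) // -/n (ltn_eqF (ltn_ord j)) addn0.
    under eq_bigr => v _ do rewrite (B_old (vjs j)) //.
    over.
  rewrite big_split /= -/n.
  over.
rewrite !big_split /= (new_pairs (fun a => h a 0%N) (fun u j => B s u j)).
rewrite (new_pairs (fun b => h 0%N b) (fun u j => B s j u)).
rewrite (exchange_big _ _ _ _ _ (fun u v : 'I_n =>
  (u != v :> nat)%:R * (B s v u * h 0%N (children s u)))) /=.
under [in X in _ = _ + (X + _)]eq_bigr => u _ do
  under eq_bigr => v _ do rewrite eq_sym.
congr (_ + _ + _).
rewrite exchange_big mulr_sumr -!big_split /=; apply: eq_bigr => u _.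
rewrite exchange_big mulr_sumr -!big_split /=; apply: eq_bigr => v _.
case: eqVneq => [_|uv].
  by rewrite !mul0r mulr0 !addr0; apply: big1 => j _; rewrite mul0r.
under eq_bigr => j _ do rewrite mul1r.
rewrite -mulr_sumr; under eq_bigr => j _ do rewrite !children_cons.
by rewrite (sum_bump2 _ _ _ (ltn_ord u) (ltn_ord v) uv) /=; ring.
Qed.

Definition above (k c : nat) : R := (k <= c)%:R.

Lemma above0 c : above 0 c = 1. Proof. by []. Qed.
Lemma aboveS0 k : above k.+1 0 = 0. Proof. by []. Qed.

Let D q k := Ex m q (diag (above k)).
Let F q k l := Ex m q (offdiag (fun a b => above k a * above l b)).

Lemma diag_ge0 g s : (forall c, 0 <= g c) -> 0 <= diag g s.
Proof. by move=> g0; apply: sumr_ge0 => u _; rewrite mulr_ge0. Qed.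

Lemma offdiag_ge0 h s : (forall a b, 0 <= h a b) -> 0 <= offdiag h s.
Proof.
by move=> h0; apply: sumr_ge0 => u _; apply: sumr_ge0 => v _; rewrite !mulr_ge0.
Qed.

Lemma eq_diag g g' s : g =1 g' -> diag g s = diag g' s.
Proof. by move=> gg; apply: eq_bigr => u _; rewrite gg. Qed.

Lemma eq_offdiag h h' s : h =2 h' -> offdiag h s = offdiag h' s.
Proof. by move=> hh; apply: eq_bigr => u _; apply: eq_bigr => v _; rewrite hh. Qed.

Lemma diag0 s : diag (fun=> 0) s = 0.
Proof. by apply: big1 => u _; rewrite mulr0. Qed.

Lemma offdiag0 s : offdiag (fun _ _ => 0) s = 0.
Proof. by apply: big1 => u _; apply: big1 => v _; rewrite !mulr0. Qed.

Lemma Ediag0 q : (m + q)%:R * D q.+1 0 = ((m + q)%:R + 1) * D q 0 + (m + q)%:R * gam.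
Proof.
rewrite /D ExS // -ExZ -[X in _ + X](Ex_cst q _ m_gt0) -ExD; apply: eq_Ex => s vs sq.
rewrite -sq; transitivity (((m + size s)%:R - 1) * diag (above 0) s + diag (above 0) s
    + 1 * (diag (above 0) s + (m + size s)%:R * gam)); first exact: diag_step.
by ring.
Qed.

(** A bump turns the threshold [k.+1] into [k], and a new vertex is below every positive
    threshold. *)
Lemma EdiagS q k : (m + q)%:R * D q.+1 k.+1 = ((m + q)%:R - 1) * D q k.+1 + D q k.
Proof.
rewrite /D ExS // -ExZ -ExD; apply: eq_Ex => s vs sq.
by rewrite -sq diag_step // aboveS0 mul0r addr0.
Qed.

Lemma Eoffdiag00 q :
  (m + q)%:R * F q.+1 0 0 = ((m + q)%:R + 2) * F q 0 0 + 2 * D q 0.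
Proof.
rewrite /D /F ExS // -!ExZ -ExD; apply: eq_Ex => s vs sq.
have e g : diag (fun a => above 0 a * g) s = g * diag (above 0) s.
  by rewrite mulr_sumr; apply: eq_bigr => u _; ring.
rewrite -sq; set f := offdiag _ s.
transitivity (((m + size s)%:R - 2) * f + f + f + (f + diag (fun a => above 0 a * 1) s)
  + (f + diag (fun a => above 0 a * 1) s)); first exact: offdiag_step.
by rewrite e; ring.
Qed.

Lemma EoffdiagS0 q k : (m + q)%:R * F q.+1 k.+1 0
  = (m + q)%:R * F q k.+1 0 + F q k 0 + D q k.
Proof.
rewrite /D /F ExS // -!ExZ -!ExD; apply: eq_Ex => s vs sq.
rewrite -sq; set n := (m + size s)%:R.
set f := offdiag (fun a b => above k.+1 a * above 0 b) s.
set f' := offdiag (fun a b => above k a * above 0 b) s.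
transitivity ((n - 2) * f + f' + f + (f + diag (fun a => above k a * 1) s)
  + (offdiag (fun a b => 0 * above 0 b) s + diag (fun b => 0 * 1) s)).
  exact: offdiag_step.
rewrite (@eq_offdiag _ (fun _ _ => 0)) ?offdiag0 => [|a b]; last by rewrite mul0r.
rewrite (@eq_diag (fun=> 0 * 1) (fun=> 0)) ?diag0 => [|a]; last by rewrite mul0r.
by rewrite (@eq_diag _ (above k)) => [|a]; [ring|rewrite mulr1].
Qed.

Lemma Eoffdiag0S q l : (m + q)%:R * F q.+1 0 l.+1
  = (m + q)%:R * F q 0 l.+1 + F q 0 l + D q l.
Proof.
rewrite /D /F ExS // -!ExZ -!ExD; apply: eq_Ex => s vs sq.
rewrite -sq; set n := (m + size s)%:R.
set f := offdiag (fun a b => above 0 a * above l.+1 b) s.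
set f' := offdiag (fun a b => above 0 a * above l b) s.
transitivity ((n - 2) * f + f + f'
  + (offdiag (fun a b => above 0 a * 0) s + diag (fun b => 1 * 0) s)
  + (f + diag (fun b => 1 * above l b) s)).
  exact: offdiag_step.
rewrite (@eq_offdiag _ (fun _ _ => 0)) ?offdiag0 => [|a b]; last by rewrite mulr0.
rewrite (@eq_diag (fun=> 1 * 0) (fun=> 0)) ?diag0 => [|a]; last by rewrite mulr0.
by rewrite (@eq_diag _ (above l)) => [|a]; [ring|rewrite mul1r].
Qed.

Lemma EoffdiagSS q k l : (m + q)%:R * F q.+1 k.+1 l.+1
  = ((m + q)%:R - 2) * F q k.+1 l.+1 + F q k l.+1 + F q k.+1 l.
Proof.
rewrite /F ExS // -!ExZ -!ExD; apply: eq_Ex => s vs sq.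
rewrite -sq; set n := (m + size s)%:R.
set f := offdiag (fun a b => above k.+1 a * above l.+1 b) s.
transitivity ((n - 2) * f + offdiag (fun a b => above k a * above l.+1 b) s
  + offdiag (fun a b => above k.+1 a * above l b) s
  + (offdiag (fun a b => above k.+1 a * 0) s + diag (fun a => above k a * 0) s)
  + (offdiag (fun a b => 0 * above l.+1 b) s + diag (fun b => 0 * above l b) s)).
  exact: offdiag_step.
rewrite (@eq_offdiag (fun a b => above k.+1 a * 0) (fun _ _ => 0)); last first.
  by move=> a b; rewrite mulr0.
rewrite (@eq_offdiag (fun a b => 0 * above l.+1 b) (fun _ _ => 0)); last first.
  by move=> a b; rewrite mul0r.
rewrite (@eq_diag (fun a => above k a * 0) (fun=> 0)) => [|a]; last by rewrite mulr0.
rewrite (@eq_diag (fun b => 0 * above l b) (fun=> 0)) => [|a]; last by rewrite mul0r.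
by rewrite offdiag0 diag0 !addr0.
Qed.

Lemma diag_start k : diag (above k.+1) [::] = 0.
Proof. by apply: big1 => u _; rewrite mulr0. Qed.

Lemma offdiag_start k l : (0 < k + l)%N ->
  offdiag (fun a b => above k a * above l b) [::] = 0.
Proof.
move=> kl; apply: big1 => u _; apply: big1 => v _.
by rewrite /children /=; case: k l kl => [|k] [|l] // _; rewrite aboveS0;
  rewrite ?mul0r ?mulr0 ?mulr0.
Qed.

(** After multiplying [EdiagS] by [2 ^+ k.+1] the coefficients are n - 1 and 2. Their sum n + 1 is
    the growth rate of [D q 0] in [Ediag0], so the bound passes from [q] to [q.+1]. *)
Lemma Ediag_le q k : 2 ^+ k * D q k <= D q 0.
Proof.
elim: q k => [|q IH] [|k]; rewrite ?mul1r //.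
  by rewrite /D /= diag_start mulr0 diag_ge0 // => c; rewrite above0.
have n0 : 0 < (m + q)%:R :> R by rewrite ltr0n; lia.
have n1 : 1 <= (m + q)%:R :> R by rewrite ler1n; lia.
rewrite -(ler_pM2l n0) mulrCA EdiagS Ediag0.
have Hk := IH k; have := IH k.+1; rewrite !exprS => HSk.
have : (2 * 2 ^+ k) * D q k.+1 * ((m + q)%:R - 1) <= D q 0 * ((m + q)%:R - 1).
  by rewrite ler_wpM2r // subr_ge0.
have := mulr_ge0 (ltW n0) gam_ge0.
lra.
Qed.

Lemma Ediag_ge0 q k : 0 <= D q k.
Proof. by apply: Ex_ge0 => s _ _; rewrite diag_ge0 // => c; rewrite ler0n. Qed.

(** The same recursion read from below. Initially no children are counted, which forces the deficit
    [2 ^+ k * D 0 0]; it is reproduced exactly, as (n - 1) 2^(k+1) + 2 * 2^k = n 2^(k+1). *)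
Lemma Ediag_ge q k : gam = 0 -> D q 0 - 2 ^+ k * D 0 0 <= 2 ^+ k * D q k.
Proof.
move=> g0; have D0 := Ediag_ge0 0 0.
elim: q k => [|q IH] [|k].
- by rewrite !mul1r subrr.
- have k1 : 1 <= 2 ^+ k.+1 :> R by rewrite exprn_ege1 // ler1n.
  have -> : D 0 k.+1 = 0 by rewrite /D /= diag_start.
  have := ler_wpM2r D0 k1; lra.
- by rewrite !mul1r gerBl.
have n0 : 0 < (m + q)%:R :> R by rewrite ltr0n; lia.
have n1 : 0 <= (m + q)%:R - 1 :> R by rewrite subr_ge0 ler1n; lia.
rewrite -(ler_pM2l n0) mulrBr [X in _ <= X]mulrCA EdiagS Ediag0 g0.
have := IH k; have := IH k.+1; rewrite !exprS => H1 H2.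
have := ler_wpM2l n1 H1; lra.
Qed.

Lemma Eoffdiag_ge0 q k l : 0 <= F q k l.
Proof.
by apply: Ex_ge0 => s _ _; rewrite offdiag_ge0 // => a b; rewrite mulr_ge0 ?ler0n.
Qed.

(** After rescaling, the coefficients n - 2, 2 and 2 of [EoffdiagSS] sum to the n + 2 of
    [Eoffdiag00]. If just one threshold is 0, a diagonal term enters and is matched by the one in
    [Eoffdiag00]. *)
Lemma Eoffdiag_le q k l : 2 ^+ (k + l) * F q k l <= F q 0 0.
Proof.
elim: q k l => [|q IH] k l.
  case: (posnP (k + l)) => [|kl]; last first.
    by rewrite {1}/F /= offdiag_start // mulr0 Eoffdiag_ge0.
  by case: k l => [|k] [|l] // _; rewrite mul1r.
have n0 : 0 < (m + q)%:R :> R by rewrite ltr0n; lia.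
rewrite -(ler_pM2l n0) mulrCA Eoffdiag00.
case: k l => [|k] [|l].
- by rewrite mul1r Eoffdiag00.
- rewrite Eoffdiag0S.
  have := IH 0%N l.+1; have := IH 0%N l; have := Ediag_le q l.
  rewrite !add0n !exprS => Hd H1 H2.
  have := ler_wpM2l (ltW n0) H2; lra.
- rewrite EoffdiagS0.
  have := IH k.+1 0%N; have := IH k 0%N; have := Ediag_le q k.
  rewrite !addn0 !exprS => Hd H1 H2.
  have := ler_wpM2l (ltW n0) H2; lra.
- rewrite EoffdiagSS.
  have := IH k.+1 l.+1; have := IH k.+1 l; have := IH k l.+1.
  rewrite !addnS !addSn !exprS => H1 H2 H3.
  have D0 := Ediag_ge0 q 0.
  (* The coefficient n - 2 is negative only for a single vertex, and then there are no off-diagonal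
     pairs. *)
  case: (leqP 2 (m + q)) => [n2|n1]; last first.
    have [m1 q0] : m = 1%N /\ q = 0%N by lia.
    have Fz (a b : nat) : F q a b = 0.
      rewrite /F q0 /=; apply: big1 => u _; apply: big1 => v _.
      have -> : u = v :> nat by have /= := ltn_ord u; have /= := ltn_ord v; lia.
      by rewrite eqxx mul0r.
    by rewrite !Fz !mulr0 !add0r mulr0 mulr_ge0.
  have n2' : 0 <= (m + q)%:R - 2 :> R by rewrite subr_ge0 ler_nat.
  have := ler_wpM2l n2' H3; lra.
Qed.

(** Adding twice the diagonal decouples the recursion of the pairs, so that the moments without
    threshold have closed forms. *)
Lemma Epsi q : (m + q)%:R * (F q.+1 0 0 + 2 * D q.+1 0)
  = ((m + q)%:R + 2) * (F q 0 0 + 2 * D q 0) + 2 * gam * (m + q)%:R.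
Proof. by rewrite mulrDr Eoffdiag00 mulrCA Ediag0; ring. Qed.

End Kernels.

(** * Ancestors *)

(** Histories now start from the single vertex 0, so the head of [j :: t'] is the parent of vertex
    [(size t').+1]. The root gets the default parent 0, hence the guards [0 < u] later on. *)
Fixpoint par (t : seq nat) (u : nat) : nat :=
  if t is j :: t' then (if u == (size t').+1 then j else par t' u) else 0%N.

(** [v] is an ancestor of [u], or [u] itself. Recursion on the history makes one growth step
    computable; [ancE] recovers the recursion along parents. *)
Fixpoint anc (t : seq nat) (v u : nat) : bool :=
  if t is j :: t'
  then (if u == (size t').+1 then (v == u) || anc t' v j else anc t' v u)
  else v == u.

Lemma anc_refl t u : anc t u u.
Proof. by elim: t => [|j t IH] /=; rewrite ?eqxx //; case: ifP. Qed.

Lemma par_lt t u : valid 1 t -> (0 < u <= size t)%N -> (par t u < u)%N.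
Proof.
elim: t => [|j t IH] /=; first by case: u.
move=> /andP[jt vt] ut; case: eqP => [->|ne]; first by lia.
by apply: IH => //; lia.
Qed.

Lemma ancE t v u : valid 1 t -> (u <= size t)%N ->
  anc t v u = (v == u) || ((0 < u)%N && anc t v (par t u)).
Proof.
elim: t v u => [|j t IH] v u /=; first by case: u => [|//]; rewrite orbF.
move=> /andP[jt vt] ut; case: eqP => [->|ne].
  by rewrite /= ifF //; lia.
have [->|u0] := posnP u; first by rewrite IH // orbF.
have pu : (par t u < u)%N by apply: par_lt => //; lia.
by rewrite IH ?u0 //=; [rewrite ifF //; lia|lia].
Qed.

Lemma anc_le t v u : valid 1 t -> (u <= size t)%N -> anc t v u -> (v <= u)%N.
Proof.
move=> vt; elim/ltn_ind: u => u IH ut; rewrite ancE // => /orP[/eqP->//|/andP[u0 a]].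
have pu : (par t u < u)%N by apply: par_lt => //; lia.
by have := IH _ pu ltac:(lia) a; lia.
Qed.

Lemma anc_root t u : valid 1 t -> (u <= size t)%N -> anc t 0 u.
Proof.
move=> vt; elim/ltn_ind: u => u IH ut; rewrite ancE //.
case: (posnP u) => [->//|u0] /=; rewrite IH ?orbT //; first by apply: par_lt => //; lia.
have := par_lt vt (_ : (0 < u <= size t)%N); lia.
Qed.

Lemma anc_cons_old j t v u : (u <= size t)%N -> anc (j :: t) v u = anc t v u.
Proof. by move=> ut /=; rewrite ifF //; lia. Qed.

Lemma anc_cons_new j t v :
  anc (j :: t) v (1 + size t)%N = (v == 1 + size t)%N || anc t v j.
Proof. by rewrite /= eqxx. Qed.

Lemma par_cons_old j t u : (u <= size t)%N -> par (j :: t) u = par t u.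
Proof. by move=> ut /=; rewrite ifF //; lia. Qed.

Lemma par_cons_new j t : par (j :: t) (1 + size t)%N = j.
Proof. by rewrite /= eqxx. Qed.

(* The vertex of the initial tree on [m] vertices whose subtree contains [u]. *)
Fixpoint blk (m : nat) (s : seq nat) (u : nat) : nat :=
  if s is j :: s' then (if u == (m + size s')%N then blk m s' j else blk m s' u)
  else u.

Lemma anc_cat s t v u : valid (size t).+1 s -> (v <= size t)%N ->
  (u < (size t).+1 + size s)%N -> anc (s ++ t) v u = anc t v (blk (size t).+1 s u).
Proof.
elim: s u => [|j s IH] u //= /andP[js vs] vt us.
rewrite size_cat addSn [in (_ + _)%N]addnC.
by case: eqP => ue; rewrite IH //; [case: eqP => // ?; lia|lia].
Qed.

Arguments anc : simpl never.
Arguments par : simpl never.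

(** * Moments of vertices with many children and of their common ancestors *)

Section Moments.
Variable R : realFieldType.

Definition harmonic (n : nat) : R := \sum_(i < n) (i.+1)%:R^-1.

Lemma harmonicS n : harmonic n.+1 = harmonic n + n.+1%:R^-1.
Proof. by rewrite /harmonic big_ord_recr. Qed.

Lemma harmonic_ge0 n : 0 <= harmonic n.
Proof. by apply: sumr_ge0 => i _; rewrite invr_ge0. Qed.

Definition countge k (t : seq nat) : R :=
  \sum_(u < 1 + size t) (k <= children t u)%N%:R.

Lemma E_countge q k : 2 ^+ k * Ex 1 q (countge k) <= (1 + q)%:R.
Proof.
pose B (s : seq nat) (u v : nat) : R := 1.
have Bnew (s : seq nat) (j : nat) : valid 1 (j :: s) ->
    B (j :: s) (1 + size s)%N (1 + size s)%N = B s j j + 0 by rewrite addr0.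
have := @Ediag_le R 1 0 B isT (lexx 0) (fun _ _ _ => ler01) ltac:(done) Bnew q k.
rewrite (_ : Ex 1 q (diag 1 B (above R 0)) = (1 + q)%:R).
  move=> le; apply: le_trans le; rewrite le_eqVlt; apply/orP; left; apply/eqP.
  by congr (_ * _); apply: eq_Ex => s _ _; apply: eq_bigr => u _; rewrite mul1r.
rewrite -[RHS](@Ex_cst R 1 q) //; apply: eq_Ex => s _ sq.
rewrite /diag (eq_bigr (fun=> 1)) => [|u _]; last by rewrite mulr1.
by rewrite sumr_const card_ord sq.
Qed.

(** The [W_v] of the overview, for the threshold [k]. *)
Definition weight k (t : seq nat) (v : nat) : R :=
  \sum_(u < 1 + size t) (anc t v u && (k <= children t u)%N)%:R.

Definition common (s : seq nat) (u u' : nat) : R :=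
  \sum_(v < 1 + size s) (anc s v u && anc s v u')%:R.

(** The sum of squares counts triples of a vertex and two descendants above the threshold, so it is
    the sum of [common] over pairs. For this kernel [gam] is 1. The two summands of the bound come
    from pairs of different vertices and from the diagonal. *)
Lemma E_weight2 q k :
  Ex 1 q (fun t => \sum_(v < 1 + size t) weight k t v ^+ 2)
  <= 2 * (1 + q)%:R ^+ 2 / 2 ^+ (k + k) + (1 + q)%:R * harmonic (1 + q) / 2 ^+ k.
Proof.
have C0 s u v : 0 <= common s u v by apply: sumr_ge0 => w _; rewrite ler0n.
have anc_big s v u : valid 1 s -> (u < 1 + size s)%N -> (size s < v)%N ->
    anc s v u = false.
  move=> vs us sv; apply: contraTF sv => /(anc_le vs us); lia.
have Cold s j u v : valid 1 (j :: s) -> (u < 1 + size s)%N -> (v < 1 + size s)%N ->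
    common (j :: s) u v = common s u v.
  move=> /andP[js vs] us vs'; rewrite /common /= addnS big_ord_recr /=.
  rewrite !anc_cons_old // anc_big // addr0.
  by apply: eq_bigr => w _; rewrite !anc_cons_old.
have Cnewl s j u : valid 1 (j :: s) -> (u < 1 + size s)%N ->
    common (j :: s) (1 + size s)%N u = common s j u.
  move=> /andP[js vs] us; rewrite /common /= addnS big_ord_recr /=.
  rewrite (anc_cons_old _ _ us) (anc_big s _ u) // andbF addr0.
  apply: eq_bigr => w _; rewrite (anc_cons_old j w us) anc_cons_new.
  by rewrite (ltn_eqF (ltn_ord w)).
have Cnewr s j u : valid 1 (j :: s) -> (u < 1 + size s)%N ->
    common (j :: s) u (1 + size s)%N = common s u j.
  have commonC s' u' v : common s' u' v = common s' v u'.
    by apply: eq_bigr => w _; rewrite andbC.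
  by move=> vjs us; rewrite commonC Cnewl // commonC.
have Cnew s j : valid 1 (j :: s) ->
    common (j :: s) (1 + size s)%N (1 + size s)%N = common s j j + 1.
  move=> /andP[js vs]; rewrite /common /= addnS big_ord_recr /= anc_cons_new eqxx.
  congr (_ + _); apply: eq_bigr => w _.
  by rewrite anc_cons_new (ltn_eqF (ltn_ord w)).
(* The expected sum of all depths, counted in vertices, is n times a harmonic number. *)
have D0 p : Ex 1 p (diag 1 common (above R 0)) = (1 + p)%:R * harmonic (1 + p).
  elim: p => [|p IH].
    rewrite /= /diag big_ord_recl big_ord0 /common big_ord_recl big_ord0.
    rewrite /harmonic big_ord_recl big_ord0 /= invr1 /above leq0n addn0 /=; ring.
  have := @Ediag0 R 1 1 common isT Cold Cnew p.
  rewrite IH -[(1 + p.+1)%N]/(1 + p).+1 harmonicS => E.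
  have n0 : 0 < (1 + p)%:R :> R by rewrite ltr0n.
  apply: (mulfI (lt0r_neq0 n0)); rewrite E -[(1 + p).+1]addn1 [(_ + 1)%:R]natrD.
  by field; apply: lt0r_neq0; lra.
(* The solution of [Epsi]; it bounds the pairs by 2 n^2. *)
have F0 p : Ex 1 p (offdiag 1 common (fun a b => above R 0 a * above R 0 b))
    + 2 * Ex 1 p (diag 1 common (above R 0)) = 2 * (1 + p)%:R ^+ 2.
  elim: p => [|p IH].
    rewrite D0 /= /offdiag !big_ord_recl !big_ord0 /harmonic big_ord_recl big_ord0.
    by rewrite /= invr1; ring.
  have n0 : (1 + p)%:R != 0 :> R by rewrite pnatr_eq0.
  apply: (mulfI n0); rewrite (@Epsi R 1 1 common isT Cold Cnewl Cnewr Cnew) IH.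
  by rewrite addnS -[(1 + p).+1]addn1 natrD; ring.
have Dk := @Ediag_le R 1 1 common isT ler01 C0 Cold Cnew q k; rewrite D0 in Dk.
have Fk := @Eoffdiag_le R 1 1 common isT ler01 C0 Cold Cnewl Cnewr Cnew q k k.
have two n : 0 < 2 ^+ n :> R by rewrite exprn_gt0.
rewrite (@eq_Ex _ _ _ _ (fun t => offdiag 1 common (fun a b => above R k a * above R k b) t
     + diag 1 common (above R k) t)); last first.
  move=> t vt tq; rewrite /offdiag /diag -big_split /=.
  transitivity (\sum_(u < 1 + size t) \sum_(u' < 1 + size t)
     common t u u' * (above R k (children t u) * above R k (children t u'))).
    under eq_bigr => v _.
      rewrite expr2 /weight mulr_suml; under eq_bigr => u _ do rewrite mulr_sumr.
      over.
    rewrite exchange_big; apply: eq_bigr => u _ /=.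
    rewrite exchange_big; apply: eq_bigr => u' _ /=.
    rewrite /common mulr_suml; apply: eq_bigr => v _.
    by rewrite -!mulnb !natrM /above; ring.
  apply: eq_bigr => u _; rewrite (bigD1 u) //= addrC; congr (_ + _).
    rewrite [RHS](bigD1 u) //= eqxx mul0r add0r; apply: eq_bigr => v uv.
    by rewrite -val_eqE eq_sym in uv; rewrite uv mul1r.
  by congr (_ * _); rewrite /above; case: (_ <= _)%N; rewrite ?mulr1 ?mulr0.
rewrite ExD; apply: lerD.
  rewrite ler_pdivlMr // mulrC (le_trans Fk) // -F0 lerDl mulr_ge0 //.
  by rewrite D0 mulr_ge0 ?harmonic_ge0.
by rewrite ler_pdivlMr // mulrC.
Qed.

End Moments.

(** * Concentration for the descendants of a set of initial vertices *)

Section Concentration.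
Variables (R : realFieldType) (m : nat) (A : pred nat).
Hypothesis m_gt0 : (0 < m)%N.

Definition colored k (s : seq nat) : R :=
  \sum_(u < m + size s) (A (blk m s u) && (k <= children s u)%N)%:R.

Let a : R := \sum_(i < m) (A i)%:R.
Let al : R := a / m%:R.
Let B (s : seq nat) (u v : nat) : R := (A (blk m s u))%:R * (A (blk m s v))%:R.

(** The kernel is a product of indicators, so the moments are those of a Polya urn with [a] of [m]
    initial balls coloured. The first term bounds the fluctuation of the limiting proportion and is
    small for large [m]; the last one collects the diagonal and the deficit of [Ediag_ge]. *)
Lemma E_colored_dev q k (n := (m + q)%:R : R) (lam := n / 2 ^+ k) :
  Ex m q (fun s => (colored k s - al * lam) ^+ 2)
  <= al / m%:R * lam ^+ 2 + lam ^+ 2 / n + al * lam * (1 + 2 * a).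
Proof.
have B0 s u v : 0 <= B s u v by rewrite mulr_ge0 ?ler0n.
have Bold s j u v : valid m (j :: s) -> (u < m + size s)%N -> (v < m + size s)%N ->
    B (j :: s) u v = B s u v.
  by move=> _ us vs; rewrite /B /= (ltn_eqF us) (ltn_eqF vs).
have Bnewl s j u : valid m (j :: s) -> (u < m + size s)%N ->
    B (j :: s) (m + size s)%N u = B s j u.
  by move=> _ us; rewrite /B /= (ltn_eqF us) eqxx.
have Bnewr s j u : valid m (j :: s) -> (u < m + size s)%N ->
    B (j :: s) u (m + size s)%N = B s u j.
  by move=> _ us; rewrite /B /= (ltn_eqF us) eqxx.
have Bnew s j : valid m (j :: s) ->
    B (j :: s) (m + size s)%N (m + size s)%N = B s j j + 0.
  by move=> _; rewrite /B /= eqxx addr0.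
have Buu s u : B s u u = (A (blk m s u))%:R.
  by rewrite /B; case: (A _); rewrite ?mulr1 ?mulr0.
have mR : 0 < m%:R :> R by rewrite ltr0n.
have m1 : 0 < m%:R + 1 :> R by lra.
have nR p : 0 < (m + p)%:R :> R by rewrite ltr0n; lia.
have a_ge0 : 0 <= a by apply: sumr_ge0 => i _; rewrite ler0n.
have a_le : a <= m%:R.
  rewrite -[m in m%:R]card_ord -sum1_card natr_sum; apply: ler_sum => i _.
  by rewrite ler_nat; case: (A i).
have start0 : diag m B (above R 0) [::] = a.
  rewrite /diag /= /a addn0; apply: eq_bigr => i _.
  by rewrite Buu /= mulr1.
have D0 p : Ex m p (diag m B (above R 0)) = al * (m + p)%:R.
  elim: p => [|p IH]; first by rewrite /= start0 addn0 /al divfK // lt0r_neq0.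
  have := @Ediag0 R m 0 B m_gt0 Bold Bnew p.
  rewrite IH mulr0 addr0 => E; apply: (mulfI (lt0r_neq0 (nR p))); rewrite E.
  by rewrite addnS -[(m + p).+1]addn1 natrD; ring.
have F0 p : Ex m p (offdiag m B (fun a b => above R 0 a * above R 0 b))
    + 2 * Ex m p (diag m B (above R 0))
    = al * (a + 1) / (m%:R + 1) * ((m + p)%:R * ((m + p)%:R + 1)).
  elim: p => [|p IH].
    have -> : Ex m 0 (offdiag m B (fun a b => above R 0 a * above R 0 b)) = a ^+ 2 - a.
      apply: (addIr a); rewrite subrK /= /offdiag /= addn0 expr2.
      rewrite /a -big_split mulr_suml; apply: eq_bigr => u _ /=.
      rewrite mulr_sumr (bigD1 u) //= eqxx mul0r add0r [RHS](bigD1 u) //= addrC.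
      congr (_ + _); first by case: (A u); rewrite ?mulr1 ?mulr0.
      apply: eq_bigr => v uv; rewrite /B /= !mulr1.
      by rewrite -val_eqE eq_sym in uv; rewrite uv mul1r.
    rewrite /= start0 addn0 /al; field.
    by rewrite !lt0r_neq0.
  apply: (mulfI (lt0r_neq0 (nR p))).
  rewrite (@Epsi R m 0 B m_gt0 Bold Bnewl Bnewr Bnew) IH.
  rewrite addnS -[(m + p).+1]addn1 natrD; field.
  by rewrite lt0r_neq0.
have Dk := @Ediag_le R m 0 B m_gt0 (lexx 0) B0 Bold Bnew q k; rewrite D0 in Dk.
have Dk' := @Ediag_ge R m 0 B m_gt0 (lexx 0) B0 Bold Bnew q k erefl.
rewrite D0 [Ex m 0 _]/= start0 in Dk'.
have Fk := @Eoffdiag_le R m 0 B m_gt0 (lexx 0) B0 Bold Bnewl Bnewr Bnew q k k.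
have two p : 0 < 2 ^+ p :> R by rewrite exprn_gt0.
have al_ge0 : 0 <= al by rewrite divr_ge0 ?ler0n.
have al_le1 : al <= 1 by rewrite /al ler_pdivrMr // mul1r.
pose Y := diag m B (above R k).
have YE s : colored k s = Y s.
  by apply: eq_bigr => u _; rewrite Buu -natrM mulnb.
have Y2 s : Y s ^+ 2 = offdiag m B (fun a b => above R k a * above R k b) s + Y s.
  rewrite /Y /offdiag /diag -big_split /= expr2 mulr_suml; apply: eq_bigr => u _.
  rewrite mulr_sumr (bigD1 u) //= addrC; congr (_ + _).
    rewrite [RHS](bigD1 u) //= eqxx mul0r add0r; apply: eq_bigr => v uv.
    rewrite -val_eqE eq_sym in uv; rewrite uv mul1r !Buu /B; ring.
  by rewrite !Buu /above; case: (A _); case: (_ <= _)%N; rewrite ?mulr1 ?mulr0.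
rewrite (@eq_Ex _ _ _ _ (fun s => offdiag m B (fun a b => above R k a * above R k b) s
   + (1 - 2 * al * lam) * Y s + (al * lam) ^+ 2)); last first.
  by move=> s _ _; rewrite YE sqrrB Y2 -mulr_natl; ring.
rewrite !ExD ExZ Ex_cst //.
set EF := Ex m q (offdiag _ _ _) in Fk *; set EY := Ex m q Y.
rewrite -/n in Dk Dk'; rewrite -/EY in Dk Dk'.
have n0 : 0 < n by apply: nR.
have lam0 : 0 < lam by rewrite divr_gt0.
have EY1 : EY <= al * lam by rewrite /lam mulrA ler_pdivlMr // mulrC.
have EY2 : al * lam - a <= EY.
  rewrite -(ler_pM2l (two k)) (le_trans _ Dk') // le_eqVlt; apply/orP; left.
  by apply/eqP; rewrite /lam; field; rewrite lt0r_neq0.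
have EF1 : EF <= al * (a + 1) / (m%:R + 1) * (lam ^+ 2 + lam ^+ 2 / n).
  rewrite -(ler_pM2l (two (k + k)%N)) (le_trans Fk) //.
  have -> : 2 ^+ (k + k) * (al * (a + 1) / (m%:R + 1) * (lam ^+ 2 + lam ^+ 2 / n))
      = al * (a + 1) / (m%:R + 1) * (n * (n + 1)).
    by rewrite /lam exprD; field; rewrite -[m%:R + q%:R]natrD !lt0r_neq0.
  by rewrite /n -F0 lerDl mulr_ge0 // D0 mulr_ge0 // ltW // nR.
have rho_le : al * (a + 1) / (m%:R + 1) <= al ^+ 2 + al / m%:R.
  have -> : al ^+ 2 + al / m%:R = al * (a + 1) / m%:R.
    by rewrite /al; field; rewrite lt0r_neq0.
  apply: ler_wpM2l; first by rewrite mulr_ge0 ?addr_ge0.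
  by rewrite lef_pV2 ?posrE //; lra.
have rho_le1 : al * (a + 1) / (m%:R + 1) <= 1.
  by rewrite ler_pdivrMr // mul1r; have := ler_wpM2r (_ : 0 <= a + 1) al_le1; lra.
have l2 : 0 <= lam ^+ 2 by rewrite exprn_ge0 // ltW.
have l2n : 0 <= lam ^+ 2 / n by rewrite divr_ge0 // ltW.
have alam : 0 <= al * lam by rewrite mulr_ge0 // ltW.
have := ler_wpM2r l2 rho_le; have := ler_wpM2r l2n rho_le1.
have := ler_wpM2l alam EY2; move: EF1 EY1.
have -> : (al * lam) ^+ 2 = al * lam * (al * lam) by rewrite expr2.
have -> : (al ^+ 2 + al / m%:R) * lam ^+ 2
    = al * lam * (al * lam) + al / m%:R * lam ^+ 2 by ring.
rewrite (mulrDr (al * (a + 1) / (m%:R + 1))).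
move: (al * (a + 1) / (m%:R + 1) * lam ^+ 2) => u.
move: (al * (a + 1) / (m%:R + 1) * (lam ^+ 2 / n)) => v.
move: (al / m%:R * lam ^+ 2) (lam ^+ 2 / n) => w z.
rewrite -(mulrA 2 al lam); move: (al * lam) => X.
lra.
Qed.

End Concentration.

(** * Exponential potentials *)

Section Potentials.
Variable R : realFieldType.

(** The expected sum S satisfies n S' = (n - 1 + z) S + n, the last term being due to the new leaf.
    The function n / (2 - z) solves this recursion and dominates at the start. *)
Lemma E_sum_pow (z : R) q : 1 <= z < 2 ->
  (2 - z) * Ex 1 q (fun t => \sum_(u < 1 + size t) z ^+ children t u) <= (1 + q)%:R.
Proof.
move=> /andP[z1 z2]; elim: q => [|q IH].
  by rewrite /= big_ord_recl big_ord0 addr0 mulr1; lra.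
have n0 : 0 < (1 + q)%:R :> R by rewrite ltr0n.
rewrite -(ler_pM2l n0) mulrCA ExS //.
rewrite (@eq_Ex _ _ _ _ (fun t => ((1 + q)%:R - 1 + z)
   * (\sum_(u < 1 + size t) z ^+ children t u) + (1 + q)%:R)); last first.
  move=> t vt tq /=; rewrite addnS -tq.
  under eq_bigr => j _ do rewrite big_ord_recr /= children_cons
    (children_new vt) // (ltn_eqF (ltn_ord j)) addn0.
  rewrite big_split /= sumr_const card_ord; congr (_ + _).
  rewrite exchange_big mulr_sumr; apply: eq_bigr => u _ /=.
  under eq_bigr => j _ do rewrite children_cons.
  by rewrite (sum_bump _ (fun c => z ^+ c) (ltn_ord u)) exprS; ring.
rewrite ExD ExZ Ex_cst // addnS -[(1 + q).+1]addn1 [(_ + 1)%:R]natrD.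
have := ler_wpM2l (_ : 0 <= (1 + q)%:R - 1 + z) IH; lra.
Qed.

Definition hubpairs k (t : seq nat) : R :=
  \sum_(y < 1 + size t)
    [&& (0 < y)%N, (k <= children t (par t y))%N & (k <= children t y)%N]%:R.

(* The base 3/2 makes the expectation of [sum z ^+ (c x + c y)] over the edges grow
   like n ^ (2 (z - 1)) = n, up to a logarithm. *)
Lemma E_hubpairs q k :
  (3 / 2) ^+ (k + k) * Ex 1 q (hubpairs k) <= 3 * (1 + q)%:R * harmonic R (1 + q).
Proof.
set z : R := 3 / 2.
pose phi t := \sum_(y < 1 + size t)
  (0 < y)%N%:R * z ^+ (children t (par t y) + children t y).
apply: (@le_trans _ _ (Ex 1 q phi)).
  rewrite -ExZ; apply: Ex_le => t _ _; rewrite mulr_sumr; apply: ler_sum => y _.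
  have z0 : 0 <= z by rewrite /z; lra.
  have z1 : 1 <= z by rewrite /z; lra.
  case: posnP => _ /=; first by rewrite !mulr0 mul0r.
  rewrite mul1r; case: (boolP (_ && _)) => [/andP[kx ky]|_].
    by rewrite mulr1 ler_weXn2l // leq_add.
  by rewrite mulr0 exprn_ge0.
elim: q => [|q IH].
  rewrite /= /phi big_ord_recl big_ord0 /= mul0r addr0.
  by rewrite !mulr_ge0 ?harmonic_ge0.
have n0 : 0 < (1 + q)%:R :> R by rewrite ltr0n.
have S := @E_sum_pow z q; have {}S := S ltac:(rewrite /z; lra).
rewrite -(ler_pM2l n0) ExS //.
(* Summed over the choices of [j], an old edge is multiplied by n - 2 + 2 z = n + 1. The new edge
   has weight z to the number of children of [j], plus one. *)
rewrite (@eq_Ex _ _ _ _ (fun t => ((1 + q)%:R + 1) * phi t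
   + z * (\sum_(u < 1 + size t) z ^+ children t u))); last first.
  move=> t vt tq; rewrite /phi /= addnS -tq.
  under eq_bigr => j _ do rewrite big_ord_recr /= mul1r par_cons_new !children_cons
    (children_new vt (leqnn _)) // (ltn_eqF (ltn_ord j)) addn0 eqxx exprS.
  rewrite big_split /= -mulr_sumr; congr (_ + _).
  rewrite exchange_big mulr_sumr; apply: eq_bigr => y _ /=.
  have [y0|y0] := posnP y; first by rewrite !mul0r mulr0; apply: big1 => j _; rewrite mul0r.
  have yt : (y <= size t)%N by rewrite -ltnS ltn_ord.
  have py : (par t y < y)%N by apply: par_lt; rewrite // y0.
  under eq_bigr => j _ do rewrite (par_cons_old j yt) !children_cons.
  rewrite -mulr_sumr !mul1r.
  rewrite (sum_bump2 _ _ (fun a b => z ^+ (a + b)) (ltn_trans py (ltn_ord y)) (ltn_ord y)) ?(ltn_eqF py) //.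
  by rewrite addnS (addSn (children t (par t y))) exprS /z; field.
  by congr (_ * _); apply: eq_bigr => i _; congr (_ ^+ _); exact: addn0.
rewrite ExD !ExZ -[(1 + q.+1)%N]/(1 + q).+1 harmonicS.
rewrite -[(1 + q).+1]addn1 [(_ + 1)%:R]natrD; set n := _%:R in n0 S *.
have -> : n * (3 * (n + 1) * (harmonic R (1 + q) + (n + 1)^-1))
    = (n + 1) * (3 * n * harmonic R (1 + q)) + 3 * n.
  by field; apply: lt0r_neq0; lra.
apply: lerD; first by apply: ler_wpM2l => //; lra.
move: S; rewrite /z; lra.
Qed.

Definition poorpairs k l (t : seq nat) : R :=
  \sum_(w < 1 + size t) \sum_(u < 1 + size t)
    [&& (w != u :> nat), anc t w u, (k <= children t u)%N & (children t w < l)%N]%:R.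

(* The bases [z = 21/10] for [u] and [x = 9/10] for [w] satisfy [z + x - 2 = 1], so
   that the potential again grows linearly up to a logarithm. *)
Lemma E_poorpairs q k l :
  (21 / 10) ^+ k * (9 / 10) ^+ l * Ex 1 q (poorpairs k l)
  <= 10 * (1 + q)%:R * harmonic R (1 + q).
Proof.
set z : R := 21 / 10; set x : R := 9 / 10.
have x0 : 0 <= x by rewrite /x; lra.
have x1 : x <= 1 by rewrite /x; lra.
have z0 : 0 <= z by rewrite /z; lra.
have z1 : 1 <= z by rewrite /z; lra.
(* [g] bounds the source term of [b]: the pairs created by a new vertex, whose proper ancestors are
   the ancestors of its parent. *)
pose g t := \sum_(w < 1 + size t) \sum_(u < 1 + size t) (anc t w u)%:R * x ^+ children t w.
pose b t := \sum_(w < 1 + size t) \sum_(u < 1 + size t)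
  ((w != u :> nat) && anc t w u)%:R * (x ^+ children t w * z ^+ children t u).
apply: (@le_trans _ _ (Ex 1 q b)).
  rewrite -ExZ; apply: Ex_le => t _ _; rewrite mulr_sumr; apply: ler_sum => w _.
  rewrite mulr_sumr; apply: ler_sum => u _; rewrite andbA.
  case: (_ && anc _ _ _) => /=; last by rewrite mulr0 mul0r.
  rewrite mul1r; case: (boolP (_ && _)) => [/andP[ku lw]|_]; last first.
    by rewrite mulr0 mulr_ge0 ?exprn_ge0.
  rewrite mulr1 mulrC; apply: ler_pM; rewrite ?exprn_ge0 //.
    by apply: ler_wiXn2l => //; apply: ltnW.
  by apply: ler_weXn2l.
have new_le t : valid 1 t -> \sum_(j < 1 + size t) \sum_(w < 1 + size t)
    (anc t w j)%:R * x ^+ ((nat_of_ord j == w) + children t w) <= g t.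
  move=> vt; rewrite exchange_big; apply: ler_sum => w _; apply: ler_sum => u _.
  by apply: ler_wpM2l; rewrite ?ler0n // ler_wiXn2l // leq_addl.
(* The recursion is n g' <= (n + x) g + n, and 10 is 1 / (1 - x). *)
have Eg p : Ex 1 p g <= 10 * (1 + p)%:R.
  elim: p => [|p IH].
    by rewrite /= /g !big_ord_recl !big_ord0 /= !addr0 mulr1; lra.
  have n0 : 0 < (1 + p)%:R :> R by rewrite ltr0n.
  have n1 : 1 <= (1 + p)%:R :> R by rewrite ler1n.
  rewrite -(ler_pM2l n0) ExS //.
  apply: (@le_trans _ _ (Ex 1 p (fun t => ((1 + p)%:R + x) * g t + (1 + p)%:R))).
    apply: Ex_le => t vt tp; rewrite /g /= addnS -tp.
    under eq_bigr => j _.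
      rewrite big_ord_recr /= [X in _ + X]big_ord_recr /= anc_refl.
      rewrite !children_cons (children_new vt (leqnn _)) (ltn_eqF (ltn_ord j)) mulr1.
      rewrite [X in _ + (X + _)]big1 ?add0r => [|u _]; last first.
        rewrite (anc_cons_old _ _ (ltn_ord u)) (_ : anc _ _ _ = false) ?mul0r //.
        by apply: contraTF (ltn_ord u) => /(anc_le vt (ltn_ord u)); rewrite -leqNgt.
      under eq_bigr => w _ do rewrite big_ord_recr /= anc_cons_new (ltn_eqF (ltn_ord w)).
      rewrite big_split /=.
      over.
    rewrite !big_split /= sumr_const card_ord lerD2r mulrDl.
    have := new_le t vt; rewrite -/(g t) => H.
    have -> : \sum_(j < 1 + size t) \sum_(w < 1 + size t) \sum_(u < 1 + size t)
        (anc (nat_of_ord j :: t) w u)%:R * x ^+ children (nat_of_ord j :: t) w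
        = ((1 + size t)%:R - 1 + x) * g t.
      rewrite exchange_big mulr_sumr; apply: eq_bigr => w _ /=.
      rewrite exchange_big mulr_sumr; apply: eq_bigr => u _ /=.
      under eq_bigr => j _ do rewrite (anc_cons_old _ _ (ltn_ord u)) children_cons.
      by rewrite -mulr_sumr (sum_bump _ (fun c => x ^+ c) (ltn_ord w)) exprS; ring.
    move: H; rewrite (eq_bigr (fun j : 'I_(1 + size t) => \sum_(w < 1 + size t)
      (anc t w j)%:R * x ^+ children (nat_of_ord j :: t) w)) => [|j _]; last first.
      by apply: eq_bigr => w _; rewrite children_cons.
    lra.
  rewrite ExD ExZ Ex_cst // addnS -[(1 + p).+1]addn1 [(_ + 1)%:R]natrD.
  have := ler_wpM2l (_ : 0 <= (1 + p)%:R + x) IH; rewrite /x; lra.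
elim: q => [|q IH].
  rewrite /= /b !big_ord_recl !big_ord0 /= !mul0r !addr0.
  by rewrite !mulr_ge0 ?harmonic_ge0.
have n0 : 0 < (1 + q)%:R :> R by rewrite ltr0n.
rewrite -(ler_pM2l n0) ExS //.
apply: (@le_trans _ _ (Ex 1 q (fun t => ((1 + q)%:R + 1) * b t + g t))).
  apply: Ex_le => t vt tq; rewrite /b /= addnS -tq.
  under eq_bigr => j _.
    rewrite big_ord_recr /= [X in _ + X]big1 ?addr0 => [|u _]; last first.
      have [un|un] := eqVneq (nat_of_ord u) (1 + size t)%N; first by rewrite mul0r.
      have us : (u < 1 + size t)%N by have := ltn_ord u; move: un; lia.
      rewrite (anc_cons_old _ _ us) (_ : anc _ _ _ = false) ?andbF ?mul0r //.
      by apply: contraTF (us) => /(anc_le vt us); rewrite -leqNgt.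
    under eq_bigr => w _ do rewrite big_ord_recr /= anc_cons_new (ltn_eqF (ltn_ord w)) /=
      !children_cons (children_new vt (leqnn _)) (ltn_eqF (ltn_ord j)) mulr1.
    rewrite big_split /=.
    over.
  rewrite big_split /=; apply: lerD; last exact: new_le.
  rewrite exchange_big mulr_sumr; apply: ler_sum => w _ /=.
  rewrite exchange_big mulr_sumr; apply: ler_sum => u _ /=.
  under eq_bigr => j _ do rewrite (anc_cons_old _ _ (ltn_ord u)) !children_cons.
  rewrite -mulr_sumr; have [wu|wu] := eqVneq; first by rewrite !mul0r mulr0.
  rewrite (sum_bump2 _ _ (fun a b => x ^+ a * z ^+ b) (ltn_ord w) (ltn_ord u) wu).
  by rewrite !exprS /x /z le_eqVlt; apply/orP; left; apply/eqP; field.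
rewrite ExD !ExZ -[(1 + q.+1)%N]/(1 + q).+1 harmonicS.
rewrite -[(1 + q).+1]addn1 [(_ + 1)%:R]natrD; set n := _%:R in n0 IH *.
have -> : n * (10 * (n + 1) * (harmonic R (1 + q) + (n + 1)^-1))
    = (n + 1) * (10 * n * harmonic R (1 + q)) + 10 * n.
  by field; apply: lt0r_neq0; lra.
by apply: lerD; [apply: ler_wpM2l => //; lra|exact: Eg].
Qed.

End Potentials.

(** * The two sides of the edge between the first two vertices *)

Section SecondVertex.
Variable R : realFieldType.

(* Vertices are numbered from [0], so [1] is the second vertex. *)
Definition sub1 (t : seq nat) : nat := (\sum_(u < 1 + size t) anc t 1 u)%N.

Lemma sub1_cons j t : valid 1 (j :: t) -> (0 < size t)%N ->
  sub1 (j :: t) = (sub1 t + anc t 1 j)%N.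
Proof.
move=> vt t0; rewrite /sub1 /= addnS big_ord_recr /= anc_cons_new.
rewrite (_ : (_ == _) = false) /=; last by lia.
by congr (_ + _)%N; apply: eq_bigr => u _; rewrite (anc_cons_old _ _ (ltn_ord u)).
Qed.

Lemma sub1_gt0 t : (0 < size t)%N -> (0 < sub1 t)%N.
Proof.
move=> t0; have t1 : (1 < 1 + size t)%N by lia.
by rewrite /sub1 (bigD1 (Ordinal t1)) //= anc_refl.
Qed.

Lemma sub1_le t : valid 1 t -> (sub1 t <= size t)%N.
Proof.
move=> vt; rewrite /sub1 big_ord_recl /=.
rewrite (_ : anc t 1 0 = false) ?add0n; last first.
  by apply/negP => /(anc_le vt (leq0n _)).
by rewrite -[X in (_ <= X)%N]card_ord -sum1_card; apply: leq_sum => i _; case: anc.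
Qed.

(* [sub1] is a Polya urn started from one ball of each colour, hence uniform. *)
Lemma E_sub1_eq q a :
  q.+1%:R * Ex 1 q.+1 (fun t => (sub1 t == a.+1)%:R : R) <= 1.
Proof.
elim: q a => [|q IH] a.
  rewrite mul1r -[X in _ <= X](@Ex_cst R 1 1) //.
  by apply: Ex_le => t _ _; rewrite lern1 leq_b1.
rewrite -[q.+2%:R]/((1 + q.+1)%:R) ExS //.
have [aq|qa] := ltnP q.+1 a.
  apply: (@le_trans _ _ (Ex 1 q.+1 (fun=> 0))); last by rewrite Ex_cst.
  apply: Ex_le => t vt tq; rewrite big1 // => j _.
  have vjt : valid 1 (nat_of_ord j :: t) by rewrite /= tq ltn_ord.
  case: (boolP (anc t 1 j)) => aj; last first.
    rewrite sub1_cons ?tq // (negPf aj) addn0 (_ : _ == _ = false) //.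
    by have := sub1_le vt; lia.
  rewrite sub1_cons ?tq // aj (_ : _ == _ = false) //.
  by have := sub1_le vt; rewrite tq; move: aq; clear; lia.
(* The value [a.+1] arises from [a] by joining the subtree, with [a] favourable parents, and from
   [a.+1] by staying outside, with [q.+1 - a] of them; together [q.+1]. *)
apply: (@le_trans _ _ (Ex 1 q.+1 (fun t =>
  a%:R * (sub1 t == a)%:R + (q.+1 - a)%:R * (sub1 t == a.+1)%:R))).
  apply: Ex_le => t vt tq.
  rewrite (eq_bigr (fun j : 'I_(1 + q.+1) => (anc t 1 j)%:R * (sub1 t == a)%:R
     + (1 - (anc t 1 j)%:R) * (sub1 t == a.+1)%:R : R)) => [|j _]; last first.
    have vjt : valid 1 (nat_of_ord j :: t) by rewrite /= tq ltn_ord.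
    rewrite sub1_cons ?tq //; case: anc => /=.
      by rewrite addn1 eqSS; ring.
    by rewrite addn0; ring.
  have E : \sum_(j < 1 + q.+1) (anc t 1 j)%:R = (sub1 t)%:R :> R.
    by rewrite /sub1 natr_sum tq.
  rewrite big_split /= -!mulr_suml sumrB E sumr_const card_ord.
  case: (eqVneq (sub1 t) a) => [->|_].
    by rewrite (_ : _ == _ = false) ?mulr0 ?addr0 //; apply/eqP; lia.
  rewrite !mulr0 !add0r; case: eqVneq => [->|_]; rewrite ?mulr0 // !mulr1 -natrB //.
rewrite ExD !ExZ -(ler_pM2l (ltr0Sn R q)) mulr1 mulrDr mulrCA [X in _ + X]mulrCA.
case: a qa => [|a] qa.
  by rewrite mul0r add0r subn0; apply: ler_piMr => //; apply: IH.
have := ler_wpM2l (ler0n R a.+1) (IH a).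
have := ler_wpM2l (ler0n R (q.+1 - a.+1)) (IH a.+1).
have : (q.+1 - a.+1)%:R + a.+1%:R = q.+1%:R :> R by rewrite -natrD subnK.
lra.
Qed.

Lemma E_sub1_small q b :
  q.+1%:R * Ex 1 q.+1 (fun t => (sub1 t <= b)%N%:R : R) <= b%:R.
Proof.
apply: (@le_trans _ _ (\sum_(a < b) q.+1%:R * Ex 1 q.+1 (fun t => (sub1 t == a.+1)%:R))).
  elim: b => [|b IH].
    rewrite big_ord0 -[X in _ <= X](mulr0 q.+1%:R) ler_wpM2l //.
    rewrite -[X in _ <= X](@Ex_cst R 1 q.+1) //; apply: Ex_le => t _ tq.
    by have := @sub1_gt0 t; rewrite tq; case: sub1 => // /(_ isT).
  rewrite big_ord_recr.
  apply: le_trans (lerD IH (lexx _)); rewrite -mulrDr -ExD ler_wpM2l //.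
  by apply: Ex_le => t _ _; rewrite -natrD ler_nat /=; lia.
rewrite -[X in _ <= X%:R]card_ord -sum1_card natr_sum; apply: ler_sum => a _.
exact: E_sub1_eq.
Qed.

Lemma E_sub1_large q b :
  q.+1%:R * Ex 1 q.+1 (fun t => (q.+2 <= sub1 t + b)%N%:R : R) <= b%:R.
Proof.
apply: (@le_trans _ _ (\sum_(i < b) q.+1%:R
    * Ex 1 q.+1 (fun t => (sub1 t == (q - i).+1)%:R))).
  elim: b => [|b IH].
    rewrite big_ord0 -[X in _ <= X](mulr0 q.+1%:R) ler_wpM2l //.
    rewrite -[X in _ <= X](@Ex_cst R 1 q.+1) //; apply: Ex_le => t vt tq.
    by have := sub1_le vt; rewrite tq addn0; case: ltngtP.
  rewrite big_ord_recr.
  apply: le_trans (lerD IH (lexx _)); rewrite -mulrDr -ExD ler_wpM2l //.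
  apply: Ex_le => t _ tq; rewrite -natrD ler_nat /=.
  by have := @sub1_gt0 t; rewrite tq => /(_ isT); lia.
rewrite -[X in _ <= X%:R]card_ord -sum1_card natr_sum; apply: ler_sum => a _.
exact: E_sub1_eq.
Qed.

(** Chebyshev. If a proportion of at least 1/L is coloured, the centre [al * lam] is at least
    [lam / L], so falling below [lam / (2 * L)] is a deviation by half the centre; hence the factor
    4. *)
Lemma E_colored_low m (A : pred nat) q k (L : nat)
    (n := (m + q)%:R : R) (lam := n / 2 ^+ k) :
  (0 < m)%N -> (0 < L)%N -> (m <= (\sum_(i < m) A i) * L)%N ->
  Ex m q (fun s => (colored R m A k s < lam / (2 * L%:R))%R%:R)
  <= 4 * (L%:R / m%:R + L%:R ^+ 2 / n + L%:R * (1 + 2 * m%:R) / lam).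
Proof.
move=> m0 L0 aL.
set a : R := \sum_(i < m) (A i)%:R.
have mR : 0 < m%:R :> R by rewrite ltr0n.
have LR : 0 < L%:R :> R by rewrite ltr0n.
have nR : 0 < n by rewrite ltr0n; lia.
have lam0 : 0 < lam by rewrite divr_gt0 // exprn_gt0.
have am : a <= m%:R.
  rewrite -[m in m%:R]card_ord -sum1_card natr_sum; apply: ler_sum => i _.
  by rewrite ler_nat; case: (A i).
have maL : m%:R <= a * L%:R by rewrite /a -natr_sum -natrM ler_nat.
have a0 : 0 < a by rewrite -(pmulr_lgt0 _ LR); apply: lt_le_trans maL.
set al := a / m%:R.
have al0 : 0 < al by rewrite divr_gt0.
have alV : al^-1 <= L%:R by rewrite /al invf_div ler_pdivrMr // mulrC.
have aV0 : 0 <= al^-1 by rewrite invr_ge0 ltW.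
have alL : L%:R^-1 <= al by rewrite -[al]invrK lef_pV2 ?posrE ?invr_gt0.
have x0 : 0 < al * lam by rewrite mulr_gt0.
apply: (@le_trans _ _ (Ex m q (fun s => (4 / (al * lam) ^+ 2)
    * (colored R m A k s - al * lam) ^+ 2))).
  apply: Ex_le => s _ _; case: ltP => [Y|_] /=; last first.
    by rewrite mulr_ge0 ?sqr_ge0 // divr_ge0 // sqr_ge0.
  have Y2 : colored R m A k s < al * lam / 2.
    apply: lt_le_trans Y _; rewrite invfM mulrCA mulrC ler_pM2r ?invr_gt0 //.
    by rewrite mulrC ler_pM2r.
  rewrite mulrAC ler_pdivlMr ?exprn_gt0 // mul1r; move: (al * lam) x0 Y2 => x; nra.
rewrite ExZ.
have := @E_colored_dev R m A m0 q k; rewrite -/a -/al -/n -/lam => /(ler_wpM2l (_ : 0 <= 4 / (al * lam) ^+ 2)).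
move=> H; apply: le_trans (H _) _; first by rewrite divr_ge0 // sqr_ge0.
have -> : 4 / (al * lam) ^+ 2 * (al / m%:R * lam ^+ 2 + lam ^+ 2 / n + al * lam * (1 + 2 * a))
    = 4 * (al^-1 / m%:R + al^-1 ^+ 2 / n + al^-1 * (1 + 2 * a) / lam).
  by clearbody lam; clearbody n al; field; rewrite !lt0r_neq0.
rewrite ler_pM2l ?ltr0n //; apply: lerD; first apply: lerD.
- by rewrite ler_pM2r ?invr_gt0.
- by rewrite ler_pM2r ?invr_gt0 // ler_pXn2r // nnegrE ltW.
- rewrite ler_pM2r ?invr_gt0 // ler_pM //; lra.
Qed.

Definition inside k (t : seq nat) : R :=
  \sum_(u < 1 + size t) (anc t 1 u && (k <= children t u)%N)%:R.

Definition outside k (t : seq nat) : R :=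
  \sum_(u < 1 + size t) (~~ anc t 1 u && (k <= children t u)%N)%:R.

Let bound (L m : nat) (n lam : R) : R :=
  L%:R^-1 + 4 * (L%:R / m%:R + L%:R ^+ 2 / n + L%:R * (1 + 2 * m%:R) / lam).

Lemma children_cat s t u : (children s u <= children (s ++ t) u)%N.
Proof. by rewrite /children count_cat leq_addr. Qed.

(** Stop at [m = L * c] vertices. As [sub1] is uniform, a given side of the first edge has at least
    [c] of them with probability at least 1 - 1/L, and then keeps its share by [E_colored_low]. *)
Lemma E_two_sides k (L c q : nat) (m := (L * c)%N) (n := (m + q)%:R : R)
    (lam := n / 2 ^+ k) :
  (0 < L)%N -> (1 < m)%N ->
  Ex 1 (m.-1 + q) (fun t => (inside k t < lam / (2 * L%:R))%R%:R) <= bound L m n lam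
  /\ Ex 1 (m.-1 + q) (fun t => (outside k t < lam / (2 * L%:R))%R%:R) <= bound L m n lam.
Proof.
move=> L0 m1; have mE : (1 + m.-1)%N = m by lia.
have LR : 0 < L%:R :> R by rewrite ltr0n.
have nR : 0 < n by rewrite ltr0n; lia.
have lam0 : 0 < lam by rewrite divr_gt0 // exprn_gt0.
set e := 4 * (L%:R / m%:R + L%:R ^+ 2 / n + L%:R * (1 + 2 * m%:R) / lam).
have e0 : 0 <= e.
  have [[LR' nR'] lam0'] := (ltW LR, ltW nR, ltW lam0).
  apply: mulr_ge0 => //; apply: addr_ge0; [apply: addr_ge0|]; apply: divr_ge0 => //.
    exact: exprn_ge0.
  by rewrite mulr_ge0 // addr_ge0 // mulr_ge0.
(* Both sides at once. The bad case of at most [c.-1] coloured vertices has probability at most (c -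
   1) / (m - 1) <= 1/L. Children received before time [m] are dropped, so [colored] only bounds [f]
   from below. *)
have key (f : seq nat -> R) (A : seq nat -> pred nat) :
    (forall s t, valid 1 t -> size t = m.-1 -> valid m s -> colored R m (A t) k s <= f (s ++ t)) ->
    m.-1%:R * Ex 1 m.-1 (fun t => ((\sum_(i < m) A t i) <= c.-1)%N%:R : R) <= c.-1%:R ->
    Ex 1 (m.-1 + q) (fun t => (f t < lam / (2 * L%:R))%R%:R) <= L%:R^-1 + e.
  move=> fA small; rewrite Ex_cat mE.
  apply: (@le_trans _ _ (Ex 1 m.-1 (fun t => ((\sum_(i < m) A t i) <= c.-1)%N%:R + e))).
    apply: Ex_le => t vt tm; case: (leqP _ c.-1) => [_|big] /=.
      rewrite -[1 + e]/(1 + e) (@le_trans _ _ 1) ?lerDl //.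
      rewrite -[X in _ <= X](@Ex_cst R m q) //; last by lia.
      by apply: Ex_le => s _ _; rewrite lern1 leq_b1.
    rewrite add0r; apply: le_trans (E_colored_low (A := A t) q k _ L0 _); last 1 first.
    - by rewrite [(_ * L)%N]mulnC leq_mul2l; apply/orP; right; lia.
    - apply: Ex_le => s vs _; rewrite ler_nat.
      case: (ltP (f _)) => // fl; rewrite (le_lt_trans _ fl) //; exact: fA.
    - by lia.
  rewrite ExD Ex_cst // lerD2r.
  have m0 : 0 < m.-1%:R :> R by rewrite ltr0n; lia.
  rewrite -(ler_pM2l m0) (le_trans small) // ler_pdivlMr // -natrM ler_nat.
  rewrite /m; nia.
have mq : m.-1 = m.-2.+1 by lia.
have size_st s t : size t = m.-1 -> (1 + size (s ++ t) = m + size s)%N.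
  by rewrite size_cat => ->; lia.
have blkE s t u : valid m s -> valid 1 t -> size t = m.-1 -> (u < m + size s)%N ->
    anc (s ++ t) 1 u = anc t 1 (blk m s u).
  move=> vs vt tm us; have tm' : (size t).+1 = m by lia.
  by rewrite anc_cat ?tm' //; lia.
have sub1E t : size t = m.-1 -> sub1 t = (\sum_(i < m) anc t 1 i)%N.
  by move=> tm; rewrite /sub1 tm mE.
split.
- apply: (key _ (fun t => anc t 1)) => [s t vt tm vs|].
    rewrite /inside (size_st _ s t tm); apply: ler_sum => u _.
    rewrite blkE // ler_nat; case: anc => //=.
    by case: (boolP (k <= children s u)%N) => //= ks; rewrite (leq_trans ks (children_cat _ _ _)).
  have := E_sub1_small m.-2 c.-1; rewrite -mq; congr (_ * _ <= _).
  by apply: eq_Ex => t _ tm; rewrite sub1E.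
- apply: (key _ (fun t u => ~~ anc t 1 u)) => [s t vt tm vs|].
    rewrite /outside (size_st _ s t tm); apply: ler_sum => u _.
    rewrite blkE // ler_nat; case: anc => //=.
    by case: (boolP (k <= children s u)%N) => //= ks; rewrite (leq_trans ks (children_cat _ _ _)).
  have := E_sub1_large m.-2 c.-1; rewrite -mq; congr (_ * _ <= _).
  apply: eq_Ex => t _ tm; rewrite sub1E //; congr (nat_of_bool _)%:R.
  have : (\sum_(i < m) anc t 1 i + \sum_(i < m) ~~ anc t 1 i = m)%N.
    rewrite -big_split /= (eq_bigr (fun=> 1%N)) ?sum1_card ?card_ord // => i _.
    by case: anc.
  by move: (\sum_(i < m) _)%N (\sum_(i < m) _)%N m1 => x y; lia.
Qed.

End SecondVertex.

(** * Candidates in an unlabelled graph *)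

Section Adjacency.
Variable n : nat.
Implicit Types (F G : sgraph n) (x y : 'I_n) (p : {perm 'I_n}).

Definition adj F x y : bool := [set x; y] \in edges F.

Definition valency F x : nat := #|[set y | adj F x y]|.

Lemma adjC F x y : adj F x y = adj F y x.
Proof. by rewrite /adj setUC. Qed.

Lemma adj_neq F x y : adj F x y -> x != y.
Proof. by move=> /card_edge; rewrite cards2; case: (x != y). Qed.

Lemma adj_gunion F G x y : adj (gunion F G) x y = adj F x y || adj G x y.
Proof. by rewrite /adj /= inE. Qed.

Lemma adj_relabel p F x y : adj (relabel p F) (p x) (p y) = adj F x y.
Proof.
rewrite /adj /= -imset_set1 -[[set p y]]imset_set1 -imsetU mem_imset //.
exact/imset_inj/perm_inj.
Qed.

Lemma sgraph_eqP F G : (forall x y, adj F x y = adj G x y) -> F = G.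
Proof.
move=> FG; apply: val_inj; apply/setP => e /=.
have sub (F' G' : sgraph n) : (forall x y, adj F' x y = adj G' x y) ->
    e \in edges F' -> e \in edges G'.
  move=> FG' eF; have /cards2P[x [y [_ ee]]] : #|e| == 2%N by rewrite (card_edge eF).
  by have := FG' x y; rewrite /adj -ee eF => <-.
by apply/idP/idP; apply: sub.
Qed.

Lemma relabelM p p' F : relabel p' (relabel p F) = relabel (p * p')%g F.
Proof.
apply: sgraph_eqP => x y; rewrite -[x](permKV (p * p')%g) -[y](permKV (p * p')%g).
by rewrite adj_relabel !permM !adj_relabel.
Qed.

Lemma relabel1 F : relabel 1%g F = F.
Proof. by apply: sgraph_eqP => x y; rewrite -{1}[x]perm1 -{1}[y]perm1 adj_relabel. Qed.

Lemma relabelK p : cancel (relabel p) (relabel p^-1%g).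
Proof. by move=> F; rewrite relabelM mulgV relabel1. Qed.

Lemma matching_unique G x y y' :
  G \in perfect_matchings n -> adj G x y -> adj G x y' -> y = y'.
Proof.
rewrite inE => /forallP/(_ x)/cards1P[e Ee] xy xy'.
have H z : adj G x z -> [set x; z] = e.
  by move=> xz; apply/set1P; rewrite -Ee !inE eqxx andbT.
have := H _ xy; rewrite -(H _ xy') => /setP/(_ y).
rewrite !inE eqxx orbT => /esym/orP[/eqP yx|/eqP //].
by have := adj_neq xy; rewrite yx eqxx.
Qed.

Lemma perfect_relabel p G :
  G \in perfect_matchings n -> relabel p G \in perfect_matchings n.
Proof.
rewrite !inE => /forallP GP; apply/forallP => v.
have /cards1P[e Ee] := GP (p^-1 v)%g; apply/cards1P; exists (p @: e).
apply/setP => f; rewrite !inE; apply/andP/eqP => [[/imsetP[g gG ->] /imsetP[w wg vw]]|->].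
  suff -> : g = e by [].
  by apply/set1P; rewrite -Ee inE gG /= vw permK.
have : e \in [set e0 in G | (p^-1)%g v \in e0] by rewrite Ee set11.
rewrite inE => /andP[eG ve]; split; first exact: imset_f.
by rewrite -[v](permKV p) imset_f.
Qed.

(** Transposing [y] and [z] carries matchings with the edge xy injectively to matchings with xz. So
    xy is in no more matchings than any other edge at [x], and a matching has one edge at [x]. *)
Lemma card_matching_adj x y : (0 < n)%N ->
  (n.-1 * #|[set G in perfect_matchings n | adj G x y]| <= #|perfect_matchings n|)%N.
Proof.
move=> n0; have [<-|xy] := eqVneq x y.
  rewrite (_ : [set _ in _ | _] = set0) ?cards0 ?muln0 //.
  by apply/setP => G; rewrite !inE; apply/negP => /andP[_ /adj_neq]; rewrite eqxx.
pose N z := #|[set G in perfect_matchings n | adj G x z]|.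
have NE z : z != x -> (N y <= N z)%N.
  move=> zx; rewrite /N -(card_imset _ (can_inj (relabelK (tperm y z)))).
  apply/subset_leq_card/subsetP => _ /imsetP[G + ->].
  rewrite [_ \in [set _ in _ | _]]inE => /andP[GP Gxy].
  rewrite inE perfect_relabel //=.
  by have := adj_relabel (tperm y z) G x y; rewrite tpermL tpermD 1?(eq_sym y) // => ->.
rewrite -/(N y) -[n in n.-1]card_ord (cardD1 x) inE add1n /=.
apply: (@leq_trans (\sum_(z in predD1 'I_n x) N z)%N).
  rewrite -sum_nat_const; apply: leq_sum => z; rewrite inE => /andP[zx _].
  exact: NE.
apply: (@leq_trans (\sum_(z : 'I_n) N z)%N).
  by rewrite big_mkcond; apply: leq_sum => z _; case: ifP.
rewrite (eq_bigr (fun z => \sum_(G in perfect_matchings n) adj G x z)%N) => [|z _].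
  rewrite exchange_big /= -sum1_card; apply: leq_sum => G GP.
  rewrite -big_mkcond sum1dep_card; apply/card_le1_eqP => z z'.
  by rewrite !inE => xz xz'; apply: (matching_unique GP xz' xz).
rewrite /N -sum1dep_card big_mkcond [RHS]big_mkcond /=; apply: eq_bigr => G _.
by case: (G \in _) => //=; case: adj.
Qed.

Section Candidates.
Variables a d1 d2 : nat.

Definition big F : {set 'I_n} := [set x | d2 <= valency F x]%N.

(* Asking a hub to have two neighbours of large valency makes hubs so rare that
   typically no two of them are matched; the interior vertices of a path of
   vertices of large valency satisfy it for free. *)
Definition hub F x : bool :=
  (d2 <= valency F x)%N || ((d1 <= valency F x)%N
    && (2 <= #|[set y | adj F x y && (d1 <= valency F y)%N]|)%N).

(** A bipartition replaces the components left by deleting [x]: edges between hubs may leave [U]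
    only towards [x]. Vertices that are not hubs may lie on either side. *)
Definition separates F x (U : {set 'I_n}) : bool :=
  [&& x \notin U,
      [forall y in U, forall z in ~: U,
         [&& z != x, adj F y z, hub F y & hub F z] ==> false],
      (#|big F| <= a * #|big F :&: U|)%N & (#|big F| <= a * #|big F :\: U|)%N].

Definition candidates F : {set 'I_n} := [set x | [exists U, separates F x U]].

Lemma valency_relabel p F x : valency (relabel p F) (p x) = valency F x.
Proof.
rewrite /valency -[RHS](card_imset _ (@perm_inj _ p)); apply/eq_card => y.
rewrite -[y](permKV p) mem_imset; last exact: perm_inj.
by rewrite !inE adj_relabel.
Qed.

Lemma big_relabel p F : big (relabel p F) = p @: big F.
Proof.
apply/setP => y; rewrite -[y](permKV p) mem_imset; last exact: perm_inj.
by rewrite !inE valency_relabel.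
Qed.

Lemma hub_relabel p F x : hub (relabel p F) (p x) = hub F x.
Proof.
rewrite /hub valency_relabel; congr (_ || (_ && (_ <= _)%N)).
rewrite -[RHS](card_imset _ (@perm_inj _ p)); apply/eq_card => y.
rewrite -[y](permKV p) mem_imset; last exact: perm_inj.
by rewrite !inE adj_relabel valency_relabel.
Qed.

Lemma separates_relabel p F x U :
  separates F x U -> separates (relabel p F) (p x) (p @: U).
Proof.
have pU y : (p y \in p @: U) = (y \in U) by rewrite mem_imset //; exact: perm_inj.
case/and4P => xU cut c1 c2; apply/and4P; split; first by rewrite pU.
- apply/forall_inP => y yU; apply/forall_inP => z zU.
  rewrite -[y](permKV p) pU in yU; rewrite -[z](permKV p) inE pU in zU.
  have /forall_inP := cut => /(_ _ yU)/forall_inP/(_ (p^-1 z)%g).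
  rewrite inE zU => /(_ isT).
  have hubE w : hub F (p^-1 w)%g = hub (relabel p F) w by rewrite -(hub_relabel p) permKV.
  have -> : ((p^-1 z)%g == x) = (z == p x) by rewrite -(inj_eq (@perm_inj _ p)) permKV.
  by rewrite !hubE -(adj_relabel p) !permKV.
- rewrite big_relabel -(imsetI (in2W (@perm_inj _ p))).
  by rewrite !card_imset //; exact: perm_inj.
- rewrite big_relabel (_ : _ :\: _ = p @: (big F :\: U)).
    by rewrite !card_imset //; exact: perm_inj.
  apply/setP => y; rewrite -[y](permKV p) inE !mem_imset ?inE //; exact: perm_inj.
Qed.

(** Equivariance: the estimator sees only the unlabelled graph. *)
Lemma candidates_relabel p F : candidates (relabel p F) = p @: candidates F.
Proof.
apply/setP => y; rewrite -[y](permKV p) mem_imset; last exact: perm_inj.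
move: (p^-1 y)%g => {}y; rewrite !inE; apply/existsP/existsP => -[U].
  by move=> /(separates_relabel p^-1); rewrite relabelK permK; eexists; eauto.
by move=> /(separates_relabel p); eexists; eauto.
Qed.

End Candidates.

End Adjacency.

(** * Noisy recursive trees *)

Lemma empty_subproof n : [forall e in (set0 : {set {set 'I_n}}), #|e| == 2%N].
Proof. by apply/forall_inP => e; rewrite inE. Qed.

Definition empty_graph n : sgraph n := SGraph (empty_subproof n).

(** For a valid history of length [n] the defaults in [head] and [inord] are never reached. *)
Fixpoint tree_graph (n : nat) (t : seq nat) : sgraph n.+1 :=
  if n is n'.+1 then attach (tree_graph n' (behead t)) (inord (head 0%N t))
  else empty_graph 1.

(** A step of [rrt_law] is a mixture over the graphs [attach F j], so integrating out the last graph
    reproduces one step of [Ex]. *)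
Lemma rrt_law_tree (R : realFieldType) n (f : sgraph n.+1 -> R) :
  \sum_(F : sgraph n.+1) rrt_law R F * f F = Ex 1 n (fun t => f (tree_graph n t)).
Proof.
elim: n f => [|n IH] f.
  rewrite (bigD1 (empty_graph 1)) //= eqxx mul1r big1 ?addr0 // => F F0.
  rewrite (_ : _ == _ = false) ?mul0r //; apply: contraNF F0 => /eqP F0.
  by apply/eqP/val_inj.
rewrite [RHS]/= -(IH (fun F => (\sum_(j < 1 + n) f (attach F (inord j))) / (1 + n)%:R)).
rewrite [LHS](eq_bigr (fun F' => \sum_(F : sgraph n.+1) rrt_law R F
  * \sum_(j < n.+1) (n.+1%:R^-1 * ((F' == attach F j)%:R * f F')))) => [|F' _].
  rewrite exchange_big; apply: eq_bigr => F _; rewrite -mulr_sumr; congr (_ * _).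
  rewrite exchange_big mulr_suml; apply: eq_bigr => j _ /=.
  rewrite -mulr_sumr mulrC (bigD1 (attach F j)) //= eqxx mul1r inord_val.
  by rewrite big1 ?addr0 // => F' /negPf ->; rewrite mul0r.
rewrite [rrt_law R F']/= mulr_suml; apply: eq_bigr => F _; rewrite -mulrA; congr (_ * _).
rewrite mulr_suml; apply: eq_bigr => j _.
by rewrite /uniform_law inE cardsT card_ord mul1r mulrA.
Qed.

Definition tadj (t : seq nat) (x y : nat) : bool :=
  ((0 < y)%N && (par t y == x)) || ((0 < x)%N && (par t x == y)).

Lemma par_le t x : valid 1 t -> (x <= size t)%N -> (par t x <= x)%N.
Proof.
move=> vt; case: (posnP x) => [->|x0 xt]; last by rewrite ltnW // par_lt // x0.
by move=> _; elim: t vt => //= j t IH /andP[_ /IH].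
Qed.

Lemma adj_tree n t (x y : 'I_n.+1) : valid 1 t -> size t = n ->
  adj (tree_graph n t) x y = tadj t x y.
Proof.
elim: n t x y => [|n IH] t x y.
  by move=> _ _; rewrite /tadj /adj inE; case: x y => [[|//] ?] [[|//] ?].
case: t => [//|j t] /= /andP[jt vt] [tn].
pose w := widen_ord (leqnSn n.+1).
have w_inj : injective w by move=> a b /(congr1 val) /= ab; apply: val_inj.
have ord_cases (z : 'I_n.+2) : (z = ord_max) \/ exists2 z', z = w z' & (z' <= size t)%N.
  have [zn|zn] := eqVneq z ord_max; [by left|right].
  have zlt : (z < n.+1)%N by have := ltn_ord z; move: zn; rewrite -val_eqE /=; lia.
  by exists (Ordinal zlt); [apply: val_inj|rewrite /= tn].
have maxw (z : 'I_n.+1) : (ord_max == w z) = false.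
  by rewrite -val_eqE /= gtn_eqF.
pose im := [set [set w x | x in e] | e : {set 'I_n.+1} in edges (tree_graph n t)].
have adjE : adj (attach (tree_graph n t) (inord j)) x y
    = ([set x; y] == [set ord_max; w (inord j)]) || ([set x; y] \in im).
  by rewrite /adj /= inE inE.
have maxim (z : 'I_n.+2) : ([set ord_max; z] \in im) = false.
  apply/negP => /imsetP[e _ /setP/(_ ord_max)].
  by rewrite !inE eqxx => /esym/imsetP[z' _ /eqP]; rewrite maxw.
have jn : (j < n.+1)%N by rewrite -tn.
have maxE (z : 'I_n.+1) : ([set ord_max; w z] == [set ord_max; w (inord j)]) = (j == z).
  apply/eqP/eqP => [/setP/(_ (w z))|jz]; last by rewrite jz inord_val.
  rewrite !inE eqxx orbT [w z == _]eq_sym maxw /= => /esym/eqP/w_inj ->.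
  by rewrite inordK.
have parm : par (j :: t) n.+1 = j by rewrite -tn par_cons_new.
have park (z : 'I_n.+1) : (z <= size t)%N -> (par (j :: t) z == n.+1) = false.
  by move=> zt; rewrite par_cons_old //; have := par_le vt zt; move: zt tn; lia.
rewrite adjE /tadj; case: (ord_cases x) => [->|[x' -> xt]].
  case: (ord_cases y) => [->|[y' -> yt]].
    rewrite maxim orbF [ord_max : nat]/= parm (ltn_eqF jn) andbF.
    apply/negP => /eqP/(congr1 (fun A : {set _} => #|A|)).
    by rewrite setUid cards1 cards2 maxw.
  by rewrite maxim orbF maxE [val ord_max]/= [val (w y')]/= parm park // andbF.
case: (ord_cases y) => [->|[y' -> yt]].
  by rewrite setUC maxim orbF maxE [val ord_max]/= [val (w x')]/= parm park // andbF orbF.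
rewrite [val (w x')]/= [val (w y')]/= !par_cons_old // -[RHS]/(tadj t x' y') -IH // /adj.
rewrite [_ == _](_ : _ = false) /=; last first.
  by apply/negP => /eqP/setP/(_ ord_max); rewrite !inE eqxx !maxw.
rewrite -[[set w x']]imset_set1 -[[set w y']]imset_set1 -imsetU mem_imset //.
exact: imset_inj.
Qed.

Lemma sum_par t x : (\sum_(y < 1 + size t) ((0 < y)%N && (par t y == x)))%N = children t x.
Proof.
elim: t => [|j t IH]; first by rewrite big_ord_recl big_ord0.
rewrite /= addnS big_ord_recr /= par_cons_new children_cons -IH addnC.
by congr (_ + _)%N; apply: eq_bigr => y _; rewrite par_cons_old // -ltnS ltn_ord.
Qed.

Lemma card_children n t (x : nat) : size t = n ->
  #|[set y : 'I_n.+1 | (0 < y)%N && (par t y == x)]| = children t x.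
Proof.
move=> <-; rewrite -sum_par -sum1dep_card big_mkcond /=; apply: eq_bigr => y _.
by case: ifP.
Qed.

(** * Deterministic analysis of hubs and candidates *)

Section Separation.
Variables (n a d1 d2 : nat) (t : seq nat) (G : sgraph n.+1).
Hypotheses (vt : valid 1 t) (tn : size t = n).
Hypothesis GP : G \in perfect_matchings n.+1.
Hypothesis d12 : (d1 <= d2)%N.
Implicit Types (x y u v w : 'I_n.+1).

Let F := gunion (tree_graph n t) G.
Let c x := children t x.

(** A condition on the tree alone, implied by being a hub, so that the independence of [G] can be
    used. A valency exceeds the number of children by at most 2, for the parent and the partner in
    the matching. *)
Definition prehub x : bool :=
  (d2 <= children t x + 2)%N || ((d1 <= children t x + 2)%N
    && [exists y : 'I_n.+1, tadj t x y && (d1 <= children t y + 2)%N]).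

Definition poor x : bool :=
  [exists w : 'I_n.+1, [&& w != x :> nat, anc t w x & (children t w < d1)%N]].

Definition nearbig : {set 'I_n.+1} := [set x : 'I_n.+1 | d2 <= children t x + 2]%N.

Hypothesis GT : forall x y, prehub x -> prehub y -> ~~ adj G x y.

Let le_n x : (x <= size t)%N. Proof. by rewrite tn -ltnS ltn_ord. Qed.

Lemma adjF x y : adj F x y = tadj t x y || adj G x y.
Proof. by rewrite adj_gunion adj_tree. Qed.

Lemma valency_ge x : (children t x <= valency F x)%N.
Proof.
rewrite -(card_children _ tn); apply/subset_leq_card/subsetP => y.
by rewrite !inE adjF /tadj => ->.
Qed.

Lemma valency_le x : (valency F x <= children t x + 2)%N.
Proof.
rewrite -(card_children _ tn).
pose P := [set y : 'I_n.+1 | (0 < x)%N && (par t x == y)].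
pose Q := [set y | adj G x y].
apply: (@leq_trans #|[set y : 'I_n.+1 | (0 < y)%N && (par t y == x)] :|: (P :|: Q)|).
  by apply/subset_leq_card/subsetP => y; rewrite !inE adjF /tadj -orbA.
apply: leq_trans (leq_card_setU _ _) _; rewrite leq_add2l.
apply: leq_trans (leq_card_setU _ _) _; rewrite (@leq_add _ _ 1 1) //.
  apply/card_le1_eqP => y z; rewrite !inE => /andP[_ /eqP yx] /andP[_ /eqP zx].
  by apply: val_inj; rewrite /= -yx.
by apply/card_le1_eqP => y z; rewrite !inE => xy xz; apply: (matching_unique GP xz xy).
Qed.

Lemma big_sub : big d2 F \subset nearbig.
Proof.
by apply/subsetP => x; rewrite !inE => xF; apply: leq_trans xF (valency_le x).
Qed.

(** Of two neighbours of large valency at most one is the partner in [G], so one is a neighbour in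
    the tree. *)
Lemma hub_prehub x : hub d1 d2 F x -> prehub x.
Proof.
rewrite /hub /prehub => /orP[h|/andP[h1 h2]].
  by rewrite (leq_trans h (valency_le x)).
rewrite (leq_trans h1 (valency_le x)) /=; apply/orP; right; apply/existsP.
have [y] : exists y, (y \in [set y | adj F x y && (d1 <= valency F y)%N]) && ~~ adj G x y.
  apply/existsP; apply: contraLR h2; rewrite negb_exists => /forallP h.
  rewrite -ltnNge ltnS; apply/card_le1_eqP => y z.
  have xG w : w \in [set y | adj F x y && (d1 <= valency F y)%N] -> adj G x w.
    by move=> wx; have := h w; rewrite wx negbK.
  by move=> /xG xy /xG xz; apply: (matching_unique GP xz xy).
rewrite inE adjF => /andP[/andP[/orP[xy|->//] dy] _]; exists y.
by rewrite xy (leq_trans dy (valency_le y)).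
Qed.

Lemma hub_adj x y : hub d1 d2 F x -> hub d1 d2 F y -> adj F x y -> tadj t x y.
Proof.
move=> /hub_prehub hx /hub_prehub hy; rewrite adjF.
by rewrite (negPf (GT hx hy)) orbF.
Qed.

(** Take for [U] the subtree of vertex 1. Edges between hubs are tree edges, and the only tree edge
    leaving this subtree ends at the root. *)
Lemma root_candidate :
  (#|nearbig| <= a * #|[set x : 'I_n.+1 | anc t 1 x && (d2 <= children t x)]|)%N ->
  (#|nearbig| <= a * #|[set x : 'I_n.+1 | ~~ anc t 1 x && (d2 <= children t x)]|)%N ->
  ord0 \in candidates a d1 d2 F.
Proof.
move=> cin cout; rewrite inE; apply/existsP; exists [set x : 'I_n.+1 | anc t 1 x].
have a10 : anc t 1 0 = false by apply/negP => /(anc_le vt (leq0n _)).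
apply/and4P; split; first by rewrite inE a10.
- apply/forall_inP => y; rewrite inE => yU; apply/forall_inP => z; rewrite !inE => zU.
  apply/implyP => /and4P[z0 yz hy hz]; case/orP: (hub_adj hy hz yz) => /andP[].
    by move=> z1 /eqP zy; rewrite ancE // z1 zy yU orbT in zU.
  move=> y0 /eqP py; move: yU; rewrite ancE // y0 py (negPf zU) orbF => /eqP y1.
  have := @par_lt t y vt; rewrite y0 le_n py -y1 => /(_ isT).
  by rewrite ltnS leqn0; move: z0; rewrite -val_eqE /= => /negPf ->.
- apply: leq_trans (subset_leq_card big_sub) (leq_trans cin _).
  rewrite leq_mul2l; apply/orP; right; apply/subset_leq_card/subsetP => x.
  by rewrite !inE => /andP[-> h]; rewrite (leq_trans h (valency_ge x)).
- apply: leq_trans (subset_leq_card big_sub) (leq_trans cout _).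
  rewrite leq_mul2l; apply/orP; right; apply/subset_leq_card/subsetP => x.
  by rewrite !inE => /andP[-> h]; rewrite (leq_trans h (valency_ge x)).
Qed.

Lemma not_poor x w : ~~ poor x -> w != x :> nat -> anc t w x ->
  (d1 <= children t w)%N.
Proof.
move=> /existsPn/(_ w) h wx ax; move: h; rewrite wx ax /= -leqNgt.
by [].
Qed.

Lemma child_of_root x : (0 < x)%N ->
  exists y : 'I_n.+1, [&& (0 < y)%N, par t y == 0%N & anc t y x].
Proof.
case: x => m mn /=; elim/ltn_ind: m mn => m IH mn m0.
have mt : (m <= size t)%N by rewrite tn -ltnS.
have pm : (par t m < m)%N by apply: par_lt; rewrite // m0.
have [p0|p0] := posnP (par t m).
  by exists (Ordinal mn); rewrite /= m0 p0 eqxx anc_refl.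
have [y /and3P[y0 py ay]] := IH _ pm (ltn_trans pm mn) p0.
by exists y; rewrite y0 py ancE // m0 ay orbT.
Qed.

Lemma two_adj x y z : y != z -> adj F x y -> adj F x z ->
  (d1 <= valency F x)%N -> (d1 <= valency F y)%N -> (d1 <= valency F z)%N ->
  hub d1 d2 F x.
Proof.
move=> yz xy xz dx dy dz; rewrite /hub dx /=; apply/orP; right.
apply: (@leq_trans #|[set y; z]|); first by rewrite cards2 yz.
apply/subset_leq_card/subsetP => w; rewrite !inE.
by case/orP => /eqP ->; apply/andP.
Qed.

Variables u1 u2 : 'I_n.+1.
Hypotheses (u1in : anc t 1 u1) (u1d : (d2 <= children t u1)%N) (u1p : ~~ poor u1).
Hypotheses (u2out : ~~ anc t 1 u2) (u2d : (d2 <= children t u2)%N) (u2p : ~~ poor u2).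
Hypothesis u20 : (0 < u2)%N.

(** All ancestors of [u1] and [u2] have many children. Among them are vertex 1 and another child of
    the root, the two neighbours that make the root a hub. *)
Lemma root_hub : hub d1 d2 F ord0.
Proof.
have u1gt : (1 <= u1)%N := anc_le vt (le_n u1) u1in.
have n1 : (1 < n.+1)%N by apply: leq_ltn_trans u1gt (ltn_ord u1).
have d_anc w u : ~~ poor u -> (d2 <= children t u)%N -> anc t w u -> (d1 <= valency F w)%N.
  move=> up ud wu; apply: leq_trans (valency_ge w).
  have [->|wu'] := eqVneq (w : nat) u; first exact: leq_trans ud.
  exact: not_poor wu.
have [y /and3P[y0 /eqP py ay]] := child_of_root u20.
apply: (@two_adj _ (Ordinal n1) y).
- by apply: contraNneq u2out => e; rewrite -e in ay.
- rewrite adjF /tadj /= (_ : par t 1 = 0%N) //.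
  by apply/eqP; rewrite -leqn0 -ltnS par_lt //= -/(1 <= size t)%N tn.
- by rewrite adjF /tadj /= y0 py eqxx.
- by apply: (d_anc _ _ u1p u1d); rewrite anc_root.
- exact: (d_anc (Ordinal n1) u1 u1p u1d).
- exact: (d_anc y u2 u2p u2d).
Qed.

(** Climb from [u] to the root. The ancestors of [u] have large valency, so an interior vertex of
    the path has two such neighbours on it and is a hub. The path avoids [v], hence never changes
    sides. *)
Lemma same_side v (U : {set 'I_n.+1}) u : separates a d1 d2 F v U ->
  ~~ anc t v u -> hub d1 d2 F u -> (d1 <= valency F u)%N -> ~~ poor u ->
  (u \in U) = (ord0 \in U).
Proof.
case/and4P => _ cut _ _.
have keep y z : adj F y z -> hub d1 d2 F y -> hub d1 d2 F z -> y != v -> z != v ->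
    (y \in U) = (z \in U).
  have half y' z' : adj F y' z' -> hub d1 d2 F y' -> hub d1 d2 F z' -> z' != v ->
      y' \in U -> z' \in U.
    move=> yz hy hz zv yU; apply: contraT => zU.
    have /forall_inP/(_ _ yU)/forall_inP/(_ z') := cut.
    by rewrite inE zU yz hy hz zv => /(_ isT).
  move=> yz hy hz yv zv; apply/idP/idP; first exact: half.
  by apply: half; rewrite // adjC.
have [m] := ubnP (nat_of_ord u); elim: m => // m IH in u * => um vu hu du up.
have [u0|u0] := posnP u; first by congr (_ \in U); apply: val_inj.
have pu : (par t u < u)%N by apply: par_lt; rewrite // u0 le_n.
pose p : 'I_n.+1 := Ordinal (ltn_trans pu (ltn_ord u)).
have ap w : anc t w p -> anc t w u by move=> wp; rewrite ancE // u0 wp orbT.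
have apw w : anc t w p -> (d1 <= children t w)%N.
  move=> wp; apply: (not_poor up); last exact: ap.
  by rewrite ltn_eqF // (leq_ltn_trans _ pu) // (anc_le vt _ wp) // (le_n p).
have dp : (d1 <= valency F p)%N by apply: leq_trans (valency_ge p); apply: apw; rewrite anc_refl.
have up_adj : adj F u p by rewrite adjF /tadj u0 eqxx orbT.
have vp : ~~ anc t v p by apply: contra vu; apply: ap.
have neq w : ~~ anc t v w -> w != v by apply: contraNneq => ->; rewrite anc_refl.
have hp : hub d1 d2 F p.
  have [p0|p0] := posnP p.
    by rewrite (_ : p = ord0) ?root_hub //; apply: val_inj.
  have pp : (par t p < p)%N by apply: par_lt; rewrite // p0 (le_n p).
  pose r : 'I_n.+1 := Ordinal (ltn_trans pp (ltn_ord p)).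
  apply: (@two_adj p u r) => //.
  - by rewrite -val_eqE /= gtn_eqF // (ltn_trans pp).
  - by rewrite adjC.
  - by rewrite adjF /tadj p0 eqxx orbT.
  - by apply: leq_trans (valency_ge r); apply: apw; rewrite ancE ?(le_n p) // p0 anc_refl orbT.
rewrite (keep u p) ?neq // IH //; first exact: (leq_trans (pu) um).
apply/existsPn => w; apply/negP => /and3P[_ /apw wd].
by rewrite ltnNge wd.
Qed.

(** Vertices of [big d2 F] that are neither poor nor below [v] are on the side of the root. The
    other side, which carries a proportion 1/a, therefore consists of exceptions. *)
Lemma few_candidates v : v \in candidates a d1 d2 F ->
  (#|big d2 F| <= a * (#|[set u in nearbig | poor u]| + #|[set u in nearbig | anc t v u]|))%N.
Proof.
rewrite inE => /existsP[U sU]; have /and4P[_ _ c1 c2] := sU.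
set X := [set u in nearbig | poor u]; set Y := [set u in nearbig | anc t v u].
have side u : u \in big d2 F -> u \notin X :|: Y -> (u \in U) = (ord0 \in U).
  move=> ub; have us := subsetP big_sub _ ub.
  rewrite !inE -!topredE /= in us *; rewrite !inE in us ub *.
  rewrite us /= negb_or => /andP[up vu]; apply: (same_side sU) => //.
    by rewrite /hub ub.
  exact: leq_trans ub.
have cXY : (#|X :|: Y| <= #|X| + #|Y|)%N := leq_card_setU _ _.
have [U0|U0] := boolP (ord0 \in U).
  apply: (leq_trans c2); rewrite leq_mul2l; apply/orP; right; apply: leq_trans cXY.
  apply/subset_leq_card/subsetP => u; rewrite in_setD => /andP[uU ub].
  by apply: contraR uU => h; rewrite (side u ub h).
apply: (leq_trans c1); rewrite leq_mul2l; apply/orP; right; apply: leq_trans cXY.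
apply/subset_leq_card/subsetP => u; rewrite in_setI => /andP[ub uU].
by apply: contraLR uU => h; rewrite (side u ub h).
Qed.

End Separation.

(** * Probability of success *)

(** Pairs 2i with 2i + 1. Without a matching the uniform law would be the zero function. *)
Lemma perfect_matching_exists n : ~~ odd n -> (0 < #|perfect_matchings n|)%N.
Proof.
move=> n_even; pose s m := if odd m then m.-1 else m.+1.
have sK m : s (s m) = m by rewrite /s; case: (boolP (odd m)) => mo; [rewrite ifF|rewrite ifT]; lia.
have s_neq m : s m != m by rewrite /s; case: ifP; case: m => //= m _; lia.
have s_lt (v : 'I_n) : (s v < n)%N.
  by have := ltn_ord v; rewrite /s; case: ifP => //; lia.
pose S (v : 'I_n) : 'I_n := Ordinal (s_lt v).
have SK v : S (S v) = v by apply: val_inj; rewrite /= sK.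
have sub : [forall e in [set [set v; S v] | v : 'I_n], #|e| == 2%N].
  by apply/forall_inP => _ /imsetP[v _ ->]; rewrite cards2 [v == _]eq_sym -val_eqE /= s_neq.
apply/card_gt0P; exists (SGraph sub); rewrite inE; apply/forallP => v.
apply/cards1P; exists [set v; S v]; apply/setP => e; rewrite !inE /=.
apply/andP/eqP => [[/imsetP[w _ ->]]|->]; last first.
  by split; [exact: imset_f|rewrite !inE eqxx].
by rewrite !inE => /orP[] /eqP ->; rewrite ?SK // setUC.
Qed.

(** * Matchings, harmonic sums and geometric rates *)

Section Bounds.
Variable R : realType.

(** Union bound over ordered pairs: by [card_matching_adj] two given vertices out of n + 1 are
    matched with probability at most 1/n. *)
Lemma matching_avoid n (X : pred 'I_n.+1) : (0 < n)%N ->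
  (0 < #|perfect_matchings n.+1|)%N ->
  \sum_(G : sgraph n.+1) uniform_law R (perfect_matchings n.+1) G
     * [exists x, exists y, [&& X x, X y & adj G x y]]%:R
  <= #|X|%:R ^+ 2 / n%:R.
Proof.
move=> n0 PM0; set PM := perfect_matchings n.+1.
have P0 : 0 < #|PM|%:R :> R by rewrite ltr0n.
apply: (@le_trans _ _ (\sum_(G : sgraph n.+1) \sum_(x | X x) \sum_(y | X y)
   #|PM|%:R^-1 * ((G \in PM) && adj G x y)%:R)).
  apply: ler_sum => G _; rewrite /uniform_law -/PM mulrAC mulrC.
  case: (boolP (G \in PM)) => GP /=; last first.
    by rewrite mul0r mulr0; apply: sumr_ge0 => x _; apply: sumr_ge0 => y _;
      rewrite ?mulr_ge0 ?invr_ge0.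
  rewrite mul1r; case: existsP => [[x /existsP[y /and3P[Xx Xy xy]]]|_] /=; last first.
    by rewrite mulr0; apply: sumr_ge0 => x _; apply: sumr_ge0 => y _; rewrite mulr_ge0 ?invr_ge0.
  rewrite (bigD1 x) //= (bigD1 y) //= xy mulr1 -addrA lerDl addr_ge0 //.
    by apply: sumr_ge0 => z _; rewrite mulr_ge0 ?invr_ge0.
  by apply: sumr_ge0 => z _; apply: sumr_ge0 => z' _; rewrite mulr_ge0 ?invr_ge0.
rewrite exchange_big /=.
apply: (@le_trans _ _ (\sum_(x | X x) \sum_(y | X y) (n%:R^-1 : R))).
  apply: ler_sum => x _; rewrite exchange_big; apply: ler_sum => y _ /=.
  rewrite -mulr_sumr ler_pdivrMl // ler_pdivlMr ?ltr0n //.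
  have := @card_matching_adj n.+1 x y isT; rewrite /= -(ler_nat R) natrM mulrC.
  apply: le_trans; rewrite ler_pM2r ?ltr0n // -sum1dep_card natr_sum [X in _ <= X]big_mkcond /=.
  by apply: ler_sum => G _; case: (_ && _).
by rewrite !sumr_const -mulrnA -[X in X <= _]mulr_natr natrM -expr2 mulrC.
Qed.

Lemma harmonic_le a b : harmonic R (a.+1 + b) <= harmonic R a.+1 + b%:R / a.+1%:R.
Proof.
elim: b => [|b IH]; first by rewrite addn0 mul0r addr0.
rewrite addnS harmonicS -[b.+1]addn1 natrD mulrDl addrA; apply: lerD => //.
by rewrite mul1r lef_pV2 ?posrE ?ltr0n // ler_nat; lia.
Qed.

Lemma harmonic_mono a b : (a <= b)%N -> harmonic R a <= harmonic R b.
Proof.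
move=> /subnK <-; rewrite addnC; elim: (b - a)%N => [|d IH]; first by rewrite addn0.
by rewrite addnS harmonicS (le_trans IH) // lerDl invr_ge0.
Qed.

(** Each doubling adds at most 1. *)
Lemma harmonic_log n k : (n <= 2 ^ k)%N -> harmonic R n <= k%:R + 1.
Proof.
move=> nk; apply: le_trans (harmonic_mono nk) _ => {n nk}; elim: k => [|k IH].
  by rewrite /harmonic expn0 big_ord_recl big_ord0 invr1 addr0 add0r.
rewrite expnS mul2n -addnn; have := expn_gt0 2 k; case E : (2 ^ k)%N => [//|a] _.
rewrite E in IH; apply: (le_trans (harmonic_le _ _)).
by rewrite divff ?pnatr_eq0 // -natr1 lerD2r.
Qed.

(** With x = s^2, the quantity (p + 1) s^p is at most 1 / (1 - s). Squaring bounds (p + 1)^2 x^p,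
    and the spare factor p + 1 gives the decay. *)
Lemma geometric_small (C x e : R) : 0 <= x < 1 -> 0 < e ->
  exists p0, forall p, (p0 <= p)%N -> C * (p.+1%:R * x ^+ p) <= e.
Proof.
move=> /andP[x0 x1] e0.
have [->|xn0] := eqVneq x 0.
  by exists 1%N => -[//|p] _; rewrite expr0n mulr0 mulr0 ltW.
have xp : 0 < x by rewrite lt0r xn0.
pose s := Num.sqrt x; have s0 : 0 < s by rewrite sqrtr_gt0.
have s2 : s ^+ 2 = x by rewrite sqr_sqrtr.
have s1 : s < 1 by rewrite -(ltr_pXn2r (_ : 0 < 2)%N) ?nnegrE ?ltW // s2 expr1n.
have bern (y : R) p : 0 < y -> y < 1 -> p.+1%:R * y ^+ p * (1 - y) <= 1.
  move=> y0 y1; have S : (1 - y) * \sum_(i < p.+1) y ^+ i = 1 - y ^+ p.+1.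
    by rewrite -[1 - y]opprB mulNr -subrX1 opprB.
  apply: (@le_trans _ _ ((1 - y) * \sum_(i < p.+1) y ^+ i)); last first.
    by rewrite S gerBl exprn_ge0 // ltW.
  rewrite mulrC; apply: ler_wpM2l; first by rewrite subr_ge0 ltW.
  rewrite mulr_natl -[X in _ *+ X](card_ord p.+1) -sumr_const; apply: ler_sum => i _.
  by apply: ler_wiXn2l; rewrite ?ltW // -ltnS.
have d0 : 0 < 1 - s by rewrite subr_gt0.
pose D := `|C| / (1 - s) ^+ 2.
have D0 : 0 <= D / e.
  by apply: divr_ge0; [apply: divr_ge0 => //; apply: exprn_ge0|]; exact: ltW.
exists (Num.bound (D / e)) => p pD.
have De : D <= e * p.+1%:R.
  rewrite mulrC -ler_pdivrMr // (le_trans (ltW (archi_boundP D0))) // ler_nat.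
  exact: leqW.
have B := bern s p s0 s1; set z := p.+1%:R * s ^+ p in B.
have z0 : 0 <= z by rewrite mulr_ge0 // exprn_ge0 // ltW.
have P0 : 0 < p.+1%:R :> R by [].
apply: (@le_trans _ _ (`|C| * (p.+1%:R * x ^+ p))).
  by rewrite ler_wpM2r ?ler_norm // mulr_ge0 // exprn_ge0.
have -> : p.+1%:R * x ^+ p = z ^+ 2 / p.+1%:R.
  by rewrite -s2 /z -exprM mulnC exprM; field; rewrite addrC natr1 lt0r_neq0.
rewrite mulrA ler_pdivrMr // (le_trans _ De) // /D ler_pdivlMr ?exprn_gt0 //.
by rewrite -mulrA -exprMn ler_piMr // exprn_ile1 // mulr_ge0 // ltW.
Qed.

End Bounds.

(** * Success on the good event *)

Section Success.
Variable R : realType.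

Lemma card_sum n (t : seq nat) (P : pred nat) : size t = n ->
  #|[set x : 'I_n.+1 | P x]|%:R = \sum_(u < 1 + size t) (P u)%:R :> R.
Proof.
move=> ->; rewrite -sum1dep_card natr_sum big_mkcond /=.
by apply: eq_bigr => u _; case: (P u).
Qed.

(** A vertex that satisfies only the second clause of [prehub] is an end of an edge counted by
    [hubpairs], and an edge has two ends. *)
Lemma card_prehub n t d1 d2 : valid 1 t -> size t = n ->
  #|@prehub n d1 d2 t|%:R <= countge R (d2 - 2) t + 2 * hubpairs R (d1 - 2) t.
Proof.
move=> vt tn; pose high x := (d1 - 2 <= children t x)%N.
pose E (x y : nat) : R := [&& (0 < y)%N, par t y == x, high x & high y]%:R.
have sumE (y : 'I_(1 + size t)) : \sum_(x < 1 + size t) E x y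
    = [&& (0 < y)%N, high (par t y) & high y]%:R.
  have py : (par t y < 1 + size t)%N.
    by have := @par_le t y vt; rewrite -ltnS ltn_ord => /(_ isT); have := ltn_ord y; lia.
  rewrite (bigD1 (Ordinal py)) //= /E eqxx /= big1 ?addr0 // => x.
  by rewrite -val_eqE /= eq_sym => /negPf ->; rewrite andbF.
have -> : 2 * hubpairs R (d1 - 2) t
    = \sum_(x < 1 + size t) \sum_(y < 1 + size t) (E x y + E y x).
  under eq_bigr => x _ do rewrite big_split /=.
  rewrite big_split /= exchange_big /= mulrDl mul1r.
  by congr (_ + _); apply: eq_bigr => y _; rewrite sumE.
rewrite -cardsE (@card_sum n t (fun x => (d2 <= children t x + 2)%N || ((d1 <= children t x + 2)%N
    && [exists y : 'I_n.+1, tadj t x y && (d1 <= children t y + 2)%N]))) //.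
rewrite /countge -big_split; apply: ler_sum => x _ /=.
have E0 u v : 0 <= E u v + E v u by rewrite addr_ge0 ?ler0n.
have S0 : 0 <= \sum_(y < 1 + size t) (E x y + E y x) by apply: sumr_ge0.
have bigE : (d2 - 2 <= children t x)%N = (d2 <= children t x + 2)%N by rewrite leq_subLR addnC.
have highE u : high u = (d1 <= children t u + 2)%N by rewrite /high leq_subLR addnC.
rewrite bigE; case: (d2 <= _)%N => /=; first by rewrite lerDl.
rewrite add0r; case: (boolP (_ && _)) => // /andP[hx /existsP[y /andP[xy hy]]].
have ys : (y < 1 + size t)%N by rewrite tn.
rewrite (bigD1 (Ordinal ys)) //= (le_trans (_ : _ <= E x y + E y x)) //; last first.
  by rewrite lerDl; apply: sumr_ge0.
rewrite /E !highE hx hy !andbT.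
rewrite -natrD ler_nat; case/orP: xy => -> //.
by rewrite addn1.
Qed.

Section Found.
Variables (n d1 d2 L C1 C2 : nat) (t : seq nat) (lam : R).
Let a := (2 * L * C1)%N.
Hypotheses (vt : valid 1 t) (tn : size t = n) (d12 : (d1 <= d2)%N).
Hypotheses (L0 : (0 < L)%N) (C10 : (0 < C1)%N) (lamL : 4 * L%:R < lam).
Hypothesis H1 : countge R (d2 - 2) t <= C1%:R * lam.
Hypothesis H2 : \sum_(v < 1 + size t) weight R (d2 - 2) t v ^+ 2 <= C2%:R * lam ^+ 2.
Hypothesis H4 : poorpairs R (d2 - 2) d1 t <= lam / (4 * L%:R * a%:R).
Hypothesis H5 : lam / (2 * L%:R) <= inside R d2 t.
Hypothesis H6 : lam / (2 * L%:R) <= outside R d2 t.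

(** With y = lam / (4 L), a candidate has weight at least y / a, so the bound on the sum of squares
    allows at most C2 lam^2 (a / y)^2 = 16 L^2 a^2 C2 candidates. *)
Lemma root_found (G : sgraph n.+1) : G \in perfect_matchings n.+1 ->
  (forall x y, prehub d1 d2 t x -> prehub d1 d2 t y -> ~~ adj G x y) ->
  let K := candidates a d1 d2 (gunion (tree_graph n t) G) in
  ord0 \in K /\ (#|K| <= 16 * L ^ 2 * a ^ 2 * C2)%N.
Proof.
move=> GP GT K.
have LR : 0 < L%:R :> R by rewrite ltr0n.
have CR : 0 < C1%:R :> R by rewrite ltr0n.
have aR : 1 <= a%:R :> R by rewrite ler1n /a; lia.
have lam0 : 0 < lam by apply: lt_trans lamL; rewrite mulr_gt0.
set F := gunion (tree_graph n t) G in K *.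
pose In := [set x : 'I_n.+1 | anc t 1 x && (d2 <= children t x)%N].
pose Out := [set x : 'I_n.+1 | ~~ anc t 1 x && (d2 <= children t x)%N].
pose Near := @nearbig n d2 t.
pose Poor := [set u in Near | poor d1 t u].
pose Below (v : nat) := [set u in Near | anc t v u].
have nearE x : (x \in Near) = (d2 - 2 <= children t x)%N by rewrite inE leq_subLR addnC.
have NearE : #|Near|%:R = countge R (d2 - 2) t.
  rewrite -[RHS](@card_sum n t (fun x => d2 - 2 <= children t x)%N tn).
  by congr _%:R; apply/eq_card => x; rewrite nearE inE.
have InE : #|In|%:R = inside R d2 t.
  exact: (@card_sum n t (fun x => anc t 1 x && (d2 <= children t x)%N) tn).
have OutE : #|Out|%:R = outside R d2 t.
  exact: (@card_sum n t (fun x => ~~ anc t 1 x && (d2 <= children t x)%N) tn).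
have BelowE v : #|Below v|%:R = weight R (d2 - 2) t v.
  rewrite -[RHS](@card_sum n t (fun x => anc t v x && (d2 - 2 <= children t x)%N) tn).
  by congr _%:R; apply/eq_card => x; rewrite !inE andbC leq_subLR addnC.
have PoorE : #|Poor|%:R <= poorpairs R (d2 - 2) d1 t.
  rewrite -sum1_card natr_sum big_mkcond /poorpairs exchange_big tn.
  apply: ler_sum => u _ /=; case: ifP; last by move=> _; apply: sumr_ge0.
  rewrite inE nearE => /andP[ub /existsP[w /and3P[wu au cw]]].
  rewrite (bigD1 w) //= wu au ub cw lerDl.
  by apply: sumr_ge0.
pose y := lam / (4 * L%:R); have y1 : 1 < y by rewrite ltr_pdivlMr ?mulr_gt0 ?mul1r.
have lamE : lam = 4 * L%:R * y by rewrite /y mulrC divfK // mulf_neq0 ?lt0r_neq0.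
have y2 : lam / (2 * L%:R) = 2 * y by rewrite lamE; field; rewrite lt0r_neq0.
have ya : lam / (4 * L%:R * a%:R) = y / a%:R.
  by rewrite /y; field; rewrite !lt0r_neq0 //; apply: lt_le_trans aR.
have a0 : 0 < a%:R :> R by apply: lt_le_trans aR.
have yay : y / a%:R <= y by rewrite ler_pdivrMr // ler_peMr // ltW // (lt_trans _ y1).
move: (H4) (H5) (H6); rewrite ya y2 => h4 h5 h6.
have aC : a%:R = 2 * L%:R * C1%:R :> R by rewrite /a !natrM.
(* The reason for [a = 2 * L * C1]: a side with 2 y = lam / (2 L) vertices is a proportion 1/a of
   [C1 * lam]. *)
have side (S : R) : 2 * y <= S -> C1%:R * lam <= a%:R * S.
  move=> yS; rewrite aC lamE.
  have := ler_wpM2l (_ : 0 <= 2 * L%:R * C1%:R) yS; rewrite !mulr_ge0 // => /(_ isT).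
  by apply: le_trans; rewrite le_eqVlt; apply/orP; left; apply/eqP; ring.
split.
  apply: root_candidate => //.
    by rewrite -(ler_nat R) natrM NearE InE (le_trans H1) // side.
  by rewrite -(ler_nat R) natrM NearE OutE (le_trans H1) // side.
(* Discarding the root and the poor vertices costs at most 1 + y, which is less than 2 y. *)
have pick (S : {set 'I_n.+1}) : 2 * y <= #|S|%:R -> S \subset Near ->
    exists u : 'I_n.+1, [/\ u \in S, ~~ poor d1 t u & (0 < u)%N].
  move=> yS SN; have : (#|ord0 |: Poor| < #|S|)%N.
    rewrite -(ltr_nat R) (lt_le_trans _ yS) // (@le_lt_trans _ _ (1 + y)) //; last lra.
    apply: (@le_trans _ _ (1 + #|Poor|%:R)); last first.
      by rewrite lerD2l (le_trans PoorE) // (le_trans h4).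
    by rewrite -[1]/(1%:R) -natrD ler_nat cardsU1 leq_add2r; case: (_ \notin _).
  rewrite ltnNge => lt; have /subsetPn[u uS] : ~~ (S \subset ord0 |: Poor).
    by apply: contra lt; apply: subset_leq_card.
  rewrite in_setU1 in_set negb_or (subsetP SN _ uS) /= => /andP[u0 up].
  by exists u; split; rewrite // lt0n; move: u0; rewrite -val_eqE.
have sub_near x : (d2 <= children t x)%N -> (d2 - 2 <= children t x)%N.
  by apply: leq_trans; apply: leq_subr.
have InNear : In \subset Near.
  by apply/subsetP => x; rewrite nearE inE => /andP[_ /sub_near].
have OutNear : Out \subset Near.
  by apply/subsetP => x; rewrite nearE inE => /andP[_ /sub_near].
have [||u1 [u1I u1p u10]] := pick In => //; first by rewrite InE.
have [||u2 [u2I u2p u20]] := pick Out => //; first by rewrite OutE.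
move: u1I u2I; rewrite !inE => /andP[u1a u1d] /andP[u2a u2d].
have Kbelow v : v \in K -> y / a%:R <= #|Below v|%:R.
  move=> /(few_candidates vt tn GP d12 u1a u1d u1p u2a u2d u2p u20).
  rewrite -(ler_nat R) natrM natrD -/(Poor) -/(Below v) => bigle.
  have InBig : In \subset big d2 F.
    apply/subsetP => x; rewrite !inE => /andP[_ dx].
    by apply: leq_trans dx _; apply: valency_ge.
  have := subset_leq_card InBig; rewrite -(ler_nat R) InE => Ib.
  have le1 : 2 * y <= a%:R * (#|Poor|%:R + #|Below v|%:R).
    exact: le_trans (le_trans h5 Ib) bigle.
  rewrite ler_pdivrMr // mulrC.
  have : a%:R * #|Poor|%:R <= y.
    by rewrite mulrC -ler_pdivlMr // (le_trans PoorE).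
  by move: le1; rewrite mulrDr; lra.
have y0 : 0 < y by apply: lt_trans y1.
have ya0 : 0 < y / a%:R by rewrite divr_gt0.
rewrite -(ler_nat R) -(ler_pM2r (exprn_gt0 2 ya0)).
apply: (@le_trans _ _ (C2%:R * lam ^+ 2)); last first.
  rewrite lamE !natrM le_eqVlt; apply/orP; left; apply/eqP.
  by field; rewrite !lt0r_neq0.
apply: le_trans H2; rewrite tn -sum1_card natr_sum mulr_suml big_mkcond /=.
apply: ler_sum => v _; case: ifP => vK; last by rewrite sqr_ge0.
rewrite mul1r -BelowE ler_pXn2r ?nnegrE //; [exact: Kbelow|exact: ltW].
Qed.

End Found.

(** The cut-off enforces the size bound on every graph and changes nothing on the good event. *)
Definition confidence_set n a d1 d2 M (F : sgraph n) : {set 'I_n} :=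
  if (#|candidates a d1 d2 F| <= M)%N then candidates a d1 d2 F else set0.

(** If a hypothesis of [root_found] on the tree or the bound [b] on the number of prehubs fails, its
    term in the bracket is at least 1 and the left side is at most 0. Otherwise only two matched
    prehubs can spoil success, with probability at most b^2 / n. *)
Lemma success_ge n d1 d2 L C1 C2 t (lam b : R) (a := (2 * L * C1)%N)
    (M := (16 * L ^ 2 * a ^ 2 * C2)%N) :
  valid 1 t -> size t = n -> (0 < n)%N -> (d1 <= d2)%N ->
  (0 < #|perfect_matchings n.+1|)%N ->
  (0 < L)%N -> (0 < C1)%N -> (0 < C2)%N -> 4 * L%:R < lam -> 0 < b ->
  1 - (countge R (d2 - 2) t / (C1%:R * lam)
       + (\sum_(v < 1 + size t) weight R (d2 - 2) t v ^+ 2) / (C2%:R * lam ^+ 2)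
       + (countge R (d2 - 2) t + 2 * hubpairs R (d1 - 2) t) / b
       + b ^+ 2 / n%:R
       + poorpairs R (d2 - 2) d1 t / (lam / (4 * L%:R * a%:R))
       + (inside R d2 t < lam / (2 * L%:R))%R%:R
       + (outside R d2 t < lam / (2 * L%:R))%R%:R)
  <= \sum_(G : sgraph n.+1) uniform_law R (perfect_matchings n.+1) G
       * (ord0 \in confidence_set a d1 d2 M (gunion (tree_graph n t) G))%:R.
Proof.
move=> vt tn n0 d12 PM0 L0 C10 C20 lamL b0.
have LR : 0 < L%:R :> R by rewrite ltr0n.
have lam0 : 0 < lam by apply: lt_trans lamL; rewrite mulr_gt0.
have aR : 0 < a%:R :> R by rewrite ltr0n /a; lia.
have nR : 0 < n%:R :> R by rewrite ltr0n.
have B1 : 0 < C1%:R * lam by rewrite mulr_gt0 ?ltr0n.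
have B2 : 0 < C2%:R * lam ^+ 2 by rewrite mulr_gt0 ?ltr0n ?exprn_gt0.
have B4 : 0 < lam / (4 * L%:R * a%:R) by rewrite divr_gt0 // !mulr_gt0.
have P0 : 0 < #|perfect_matchings n.+1|%:R :> R by rewrite ltr0n.
have u0 G : 0 <= uniform_law R (perfect_matchings n.+1) G by rewrite divr_ge0.
set X1 := countge R _ t; set X2 := \sum_(v < _) _; set X3 := 2 * _.
set X4 := poorpairs R _ _ t; set X5 := (inside _ _ _ < _)%R; set X6 := (outside _ _ _ < _)%R.
set S := \sum_(G : sgraph n.+1) _.
have S0 : 0 <= S by apply: sumr_ge0 => G _; rewrite mulr_ge0.
have X10 : 0 <= X1 by apply: sumr_ge0.
have X20 : 0 <= X2 by apply: sumr_ge0 => v _; rewrite sqr_ge0.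
have X30 : 0 <= X3 by rewrite mulr_ge0 //; apply: sumr_ge0.
have X40 : 0 <= X4 by apply: sumr_ge0 => v _; apply: sumr_ge0.
have Y1 : 0 <= X1 / (C1%:R * lam) by rewrite divr_ge0 // ltW.
have Y2 : 0 <= X2 / (C2%:R * lam ^+ 2) by rewrite divr_ge0 // ltW.
have Y3 : 0 <= (X1 + X3) / b by rewrite divr_ge0 ?addr_ge0 // ltW.
have Y4 : 0 <= X4 / (lam / (4 * L%:R * a%:R)) by rewrite divr_ge0 // ltW.
have Yb : 0 <= b ^+ 2 / n%:R by rewrite divr_ge0 ?sqr_ge0.
have Y5 : 0 <= X5%:R :> R by [].
have Y6 : 0 <= X6%:R :> R by [].
have big (x B : R) : 0 < B -> B < x -> 1 <= x / B.
  by move=> B0 Bx; rewrite ler_pdivlMr // mul1r ltW.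
case: (leP X1 (C1%:R * lam)) => [H1|/(big _ _ B1)]; last lra.
case: (leP X2 (C2%:R * lam ^+ 2)) => [H2|/(big _ _ B2)]; last lra.
case: (leP (X1 + X3) b) => [H3|/(big _ _ b0)]; last lra.
case: (leP X4 (lam / (4 * L%:R * a%:R))) => [H4|/(big _ _ B4)]; last lra.
case: (boolP X5) => [_|]; first by rewrite (_ : true%:R = 1 :> R) //; lra.
rewrite -leNgt (_ : false%:R = 0 :> R) // => H5.
case: (boolP X6) => [_|]; first by rewrite (_ : true%:R = 1 :> R) //; lra.
rewrite -leNgt (_ : false%:R = 0 :> R) // => H6.
apply: (@le_trans _ _ (1 - b ^+ 2 / n%:R)); first lra.
pose X := @prehub n d1 d2 t.
pose E (G : sgraph n.+1) := [exists x, exists y, [&& X x, X y & adj G x y]].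
have cX : #|X|%:R <= b := le_trans (card_prehub d1 d2 vt tn) H3.
apply: (@le_trans _ _ (\sum_(G : sgraph n.+1)
    (uniform_law R (perfect_matchings n.+1) G
     - uniform_law R (perfect_matchings n.+1) G * (E G)%:R))).
  rewrite sumrB lerB //.
    rewrite (eq_bigr (fun G => (G \in perfect_matchings n.+1)%:R / #|perfect_matchings n.+1|%:R)) //.
    by rewrite -mulr_suml -natr_sum -big_mkcond sum1_card divff // lt0r_neq0.
  apply: le_trans (matching_avoid R X n0 PM0) _.
  rewrite ler_pM2r ?invr_gt0 // ler_pXn2r ?nnegrE //.
  exact: ltW.
apply: ler_sum => G _; rewrite -[X in X - _]mulr1 -mulrBr.
rewrite /uniform_law; case: (boolP (G \in _)) => [GP|_]; last by rewrite !mul0r.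
rewrite ler_wpM2l ?divr_ge0 //.
case: (boolP (E G)) => [_|]; first by rewrite subrr.
rewrite subr0 negb_exists => /forallP noE.
have GT x y : prehub d1 d2 t x -> prehub d1 d2 t y -> ~~ adj G x y.
  move=> px py; have := noE x; rewrite negb_exists => /forallP/(_ y).
  by rewrite /X px py.
have [r0 cK] := root_found vt tn d12 L0 C10 lamL H1 H2 H4 H5 H6 GP GT.
by rewrite /confidence_set cK r0.
Qed.
End Success.

(* With n about 2 ^ (46 p), the thresholds d2 = 45 p and d1 = 20 p leave about 2 ^ p
   vertices in S. The ratio 4/9 = d1 / d2 has to be large enough for [hub_rate] (few
   hubs) and small enough for [poor_rate] (few ancestors of low degree). *)
Section Numerics.
Variable R : realType.

(** Per unit of [p]: n (2/3)^(2 d1), the order of the number of hubs, against 2^(23 p), the order of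
    sqrt n. *)
Lemma hub_rate : (2 : R) ^+ 46 * (2 / 3) ^+ 40 / 2 ^+ 23 <= 4 / 5.
Proof.
rewrite ler_pdivrMr ?exprn_gt0 // expr_div_n mulrA ler_pdivrMr ?exprn_gt0 //.
lra.
Qed.

(** Per unit of [p]: the bound of [E_poorpairs] divided by [lam]. *)
Lemma poor_rate : (2 : R) ^+ 45 * (10 / 21) ^+ 45 * (10 / 9) ^+ 20 <= 23 / 25.
Proof.
(* The fifth root is estimated first, which keeps the numbers small. *)
have r0 : 0 <= (20 / 21 : R) ^+ 9 * (10 / 9) ^+ 4.
  by rewrite mulr_ge0 // exprn_ge0 // divr_ge0.
have r : (20 / 21 : R) ^+ 9 * (10 / 9) ^+ 4 <= 983 / 1000.
  rewrite !expr_div_n mulrA ler_pdivrMr ?exprn_gt0 // mulrAC ler_pdivrMr ?exprn_gt0 //.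
  lra.
have -> : (2 : R) ^+ 45 * (10 / 21) ^+ 45 * (10 / 9) ^+ 20
    = ((20 / 21 : R) ^+ 9 * (10 / 9) ^+ 4) ^+ 5.
  rewrite -exprMn (_ : 2 * (10 / 21) = 20 / 21 :> R); last by field.
  by rewrite [RHS]exprMn -!exprM.
apply: (@le_trans _ _ ((983 / 1000) ^+ 5)); last by lra.
by rewrite ler_pXn2r ?nnegrE // divr_ge0.
Qed.

Variables (n p L c C1 C2 : nat) (beta : R).
Let N : R := n.+1%:R.
Let d1 := (20 * p)%N.
Let d2 := (45 * p)%N.
Let lam : R := N / 2 ^+ d2.
Let H := harmonic R n.+1.
Hypotheses (p0 : (0 < p)%N) (n0 : (0 < n)%N).
Hypotheses (Nlow : (2 ^ (46 * p) <= n.+1)%N) (Nhigh : (n.+1 <= 2 ^ (46 * p + 46))%N).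

Let T : R := 2 ^+ 46.

Let N0 : 0 < N. Proof. by rewrite ltr0n. Qed.

Let two k : 0 < 2 ^+ k :> R. Proof. by rewrite exprn_gt0. Qed.

Let lam0 : 0 < lam. Proof. by rewrite divr_gt0. Qed.

Let N_le : N <= T * 2 ^+ (46 * p).
Proof.
rewrite -exprD addnC /N.
by have := Nhigh; rewrite -(ler_nat R) natrX.
Qed.

Lemma lam_ge : 2 ^+ p <= lam.
Proof.
rewrite ler_pdivlMr // -exprD; have := Nlow; rewrite -(ler_nat R) natrX.
by rewrite (_ : p + d2 = 46 * p)%N //; rewrite /d2; lia.
Qed.

Let lam_le : lam <= T * 2 ^+ p.
Proof.
rewrite ler_pdivrMr // -mulrA -exprD (_ : p + d2 = 46 * p)%N //.
Qed.

Let H_le : H <= 47 * p.+1%:R.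
Proof.
apply: le_trans (harmonic_log R Nhigh) _.
rewrite natrD natrM -natr1; have : 0 <= p%:R :> R by []. lra.
Qed.

Let H0 : 0 <= H. Proof. exact: harmonic_ge0. Qed.

Let d2E (z : R) : z ^+ d2 = z ^+ 2 * z ^+ (d2 - 2).
Proof. by rewrite -exprD subnKC // /d2; lia. Qed.

Lemma E_near : Ex 1 n (countge R (d2 - 2)) <= 4 * lam.
Proof.
have := E_countge R n (d2 - 2); rewrite mulrC -ler_pdivlMr // add1n => h.
apply: (le_trans h); rewrite le_eqVlt; apply/orP; left; apply/eqP.
by rewrite /lam -/N d2E; field; rewrite lt0r_neq0.
Qed.

(** 220 is 32 + 4 * 47: the pairs give 2 * 2^4, the thresholds being lowered by 2, and the diagonal
    is bounded by [H_le] and p + 1 <= 2^p <= lam. *)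
Lemma E_weights : Ex 1 n (fun t => \sum_(v < 1 + size t) weight R (d2 - 2) t v ^+ 2)
  <= 220 * lam ^+ 2.
Proof.
apply: (le_trans (E_weight2 R n (d2 - 2))); rewrite !add1n -/N -/H.
have -> : 2 * N ^+ 2 / 2 ^+ (d2 - 2 + (d2 - 2)) + N * H / 2 ^+ (d2 - 2)
    = 32 * lam ^+ 2 + 4 * H * lam.
  by rewrite /lam d2E exprD; field; rewrite lt0r_neq0.
have : H * lam <= 47 * lam ^+ 2.
  rewrite expr2 mulrA ler_pM2r // (le_trans H_le) // ler_pM2l // (le_trans _ lam_ge) //.
  by rewrite -natrX ler_nat ltn_expl.
lra.
Qed.

(** The factor 2^46 is the slack of n for a given [p], (3/2)^4 undoes the shift in [d1 - 2], and 282
    is 2 * 3 * 47. *)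
Lemma E_hubs : (Ex 1 n (countge R (d2 - 2)) + 2 * Ex 1 n (hubpairs R (d1 - 2))) / 2 ^+ (23 * p)
  <= (4 * T + 282 * T * (3 / 2) ^+ 4) * (p.+1%:R * (4 / 5) ^+ p).
Proof.
have h0 : (0 : R) < 3 / 2 by rewrite divr_gt0.
have hk k : 0 < (3 / 2 : R) ^+ k by rewrite exprn_gt0.
have Eh : Ex 1 n (hubpairs R (d1 - 2)) <= 141 * T * (3 / 2) ^+ 4 * p.+1%:R
    * (2 ^+ 46 * (2 / 3) ^+ 40) ^+ p.
  have := E_hubpairs R n (d1 - 2); rewrite mulrC -ler_pdivlMr // !add1n -/N -/H => h.
  apply: (le_trans h); rewrite ler_pdivrMr //.
  have -> : 141 * T * (3 / 2) ^+ 4 * p.+1%:R * (2 ^+ 46 * (2 / 3) ^+ 40) ^+ p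
      * (3 / 2) ^+ (d1 - 2 + (d1 - 2)) = 3 * (T * 2 ^+ (46 * p)) * (47 * p.+1%:R).
    have e : (2 / 3 : R) ^+ (40 * p) * ((3 / 2) ^+ 4 * (3 / 2) ^+ (d1 - 2 + (d1 - 2))) = 1.
      rewrite -exprD (_ : 4 + (d1 - 2 + (d1 - 2)) = 40 * p)%N; last by rewrite /d1; lia.
      by rewrite -exprMn (_ : 2 / 3 * (3 / 2) = 1 :> R) ?expr1n //; field.
    rewrite [(_ * (2 / 3) ^+ 40) ^+ p]exprMn -[(2 ^+ 46) ^+ p]exprM -[((2 / 3) ^+ 40) ^+ p]exprM.
    move: e; move: ((2 / 3 : R) ^+ (40 * p)) ((3 / 2 : R) ^+ 4)
      ((3 / 2 : R) ^+ (d1 - 2 + (d1 - 2))) ((2 : R) ^+ (46 * p)) (p.+1%:R : R).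
    move=> x y z u v e; transitivity (3 * (T * u) * (47 * v) * (x * (y * z))); first by ring.
    by rewrite e mulr1.
  apply: ler_pM => //; first by rewrite mulr_ge0 // ltW.
  by rewrite ler_pM2l.
have T0 : 0 < T := two 46.
rewrite ler_pdivrMr //; set A : R := 4 / 5 * 2 ^+ 23.
have A2 : 2 <= A by rewrite /A; lra.
have A0 : 0 <= A by apply: le_trans A2.
have -> : (4 * T + 282 * T * (3 / 2) ^+ 4) * (p.+1%:R * (4 / 5) ^+ p) * 2 ^+ (23 * p)
    = 4 * T * (p.+1%:R * A ^+ p) + 282 * T * (3 / 2) ^+ 4 * (p.+1%:R * A ^+ p).
  rewrite (_ : A ^+ p = (4 / 5) ^+ p * 2 ^+ (23 * p)); last by rewrite exprMn exprM.
  by ring.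
apply: lerD.
  apply: (le_trans E_near); rewrite -mulrA ler_pM2l // (le_trans lam_le) // ler_pM2l //.
  apply: (@le_trans _ _ (A ^+ p)); first by rewrite ler_pXn2r ?nnegrE.
  by rewrite ler_peMl ?exprn_ge0 // ler1n.
apply: (@le_trans _ _ (2 * (141 * T * (3 / 2) ^+ 4 * p.+1%:R
    * (2 ^+ 46 * (2 / 3) ^+ 40) ^+ p))); first by rewrite ler_pM2l.
have rate : (2 ^+ 46 * (2 / 3) ^+ 40 : R) ^+ p <= A ^+ p.
  rewrite ler_pXn2r ?nnegrE ?mulr_ge0 ?exprn_ge0 ?invr_ge0 //.
  by have := hub_rate; rewrite ler_pdivrMr.
have c_ge0 : 0 <= 282 * T * (3 / 2) ^+ 4 * p.+1%:R.
  by apply: mulr_ge0 => //; apply: mulr_ge0; [apply: mulr_ge0 => //|]; exact: ltW.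
rewrite [leRHS]mulrA; apply: le_trans (ler_wpM2l c_ge0 rate).
by rewrite le_eqVlt; apply/orP; left; apply/eqP; ring.
Qed.

(** 470 is 10 * 47, from [E_poorpairs] and [H_le]; (21/10)^2 undoes the shift in [d2 - 2]. *)
Lemma E_poor (K : R) : 0 < K -> Ex 1 n (poorpairs R (d2 - 2) d1) / (lam / K)
  <= 470 * (21 / 10) ^+ 2 * K * (p.+1%:R * (23 / 25) ^+ p).
Proof.
move=> K0; have z0 k : 0 < (21 / 10 : R) ^+ k by rewrite exprn_gt0 // divr_gt0.
have x0 k : 0 < (9 / 10 : R) ^+ k by rewrite exprn_gt0 // divr_gt0.
have := E_poorpairs R n (d2 - 2) d1; rewrite mulrC -ler_pdivlMr ?mulr_gt0 // !add1n -/N -/H => h.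
have [K0' N0'] := (ltW K0, ltW N0).
apply: (@le_trans _ _ (10 * N * H / ((21 / 10) ^+ (d2 - 2) * (9 / 10) ^+ d1) / (lam / K))).
  by rewrite ler_pM2r // invr_gt0 divr_gt0.
have -> : 10 * N * H / ((21 / 10) ^+ (d2 - 2) * (9 / 10) ^+ d1) / (lam / K)
    = 10 * (21 / 10) ^+ 2 * K * H * (2 ^+ 45 * (10 / 21) ^+ 45 * (10 / 9) ^+ 20) ^+ p.
  have e : (10 / 21 : R) ^+ d2 * ((21 / 10) ^+ 2 * (21 / 10) ^+ (d2 - 2)) = 1.
    by rewrite -d2E -exprMn (_ : 10 / 21 * (21 / 10) = 1 :> R) ?expr1n //; field.
  have e' : (10 / 9 : R) ^+ d1 * (9 / 10) ^+ d1 = 1.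
    by rewrite -exprMn (_ : 10 / 9 * (9 / 10) = 1 :> R) ?expr1n //; field.
  rewrite [(_ * (10 / 9) ^+ 20) ^+ p]exprMn [(_ * (10 / 21) ^+ 45) ^+ p]exprMn.
  rewrite -[(2 ^+ 45) ^+ p]exprM -[((10 / 21) ^+ 45) ^+ p]exprM -[((10 / 9) ^+ 20) ^+ p]exprM.
  rewrite -/d1 -/d2 /lam; have := two d2; have := z0 (d2 - 2)%N; have := x0 d1.
  move: e e'; move: ((10 / 21 : R) ^+ d2) ((21 / 10 : R) ^+ 2) ((21 / 10 : R) ^+ (d2 - 2))
    ((2 : R) ^+ d2) ((10 / 9 : R) ^+ d1) ((9 / 10 : R) ^+ d1) => x y z u v w e e' w0 z0' u0.
  move: (N0); move: (N) (H) => M h' M0.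
  transitivity (10 * K * h' * u / (z * w)).
    by field; rewrite !lt0r_neq0.
  transitivity (10 * K * h' * u * (x * (y * z)) * (v * w) / (z * w)).
    by rewrite e e' !mulr1.
  by field; rewrite !lt0r_neq0.
rewrite [leRHS](_ : _ = 10 * (21 / 10) ^+ 2 * K * (47 * p.+1%:R) * (23 / 25) ^+ p); last by ring.
have c_gt0 : 0 < 10 * (21 / 10) ^+ 2 * K.
  by apply: mulr_gt0 => //; apply: mulr_gt0.
have q_ge0 : 0 <= (2 : R) ^+ 45 * (10 / 21) ^+ 45 * (10 / 9) ^+ 20.
  by apply: mulr_ge0; [apply: mulr_ge0|]; apply: exprn_ge0 => //; apply: divr_ge0.
apply: ler_pM; first by apply: mulr_ge0 => //; exact: ltW.
- exact: exprn_ge0.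
- by rewrite ler_pM2l.
- by apply: lerXn2r; rewrite ?nnegrE ?poor_rate // divr_ge0.
Qed.

End Numerics.

(** * Assembling the probability bound *)

Section Conclusion.
Variable R : realType.

Lemma Pr_product3 (S T U : finType) (mu : S -> R) (nu : T -> R) (rho : U -> R)
    (A : pred (S * T * U)) :
  Pr (product_law (product_law mu nu) rho) A
  = \sum_s mu s * \sum_t nu t * \sum_u rho u * (A (s, t, u))%:R.
Proof.
rewrite /Pr big_mkcond /= (eq_bigr (fun x => product_law mu nu x.1 * (rho x.2 * (A x)%:R))).
  rewrite (eq_bigr (fun x => (fun y u => product_law mu nu y * (rho u * (A (y, u))%:R)) x.1 x.2)).
    rewrite -(pair_bigA _ (fun y u => product_law mu nu y * (rho u * (A (y, u))%:R))) /=.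
    rewrite (eq_bigr (fun y => (fun s t => mu s * (nu t * \sum_u rho u * (A (s, t, u))%:R)) y.1 y.2)).
      rewrite -(pair_bigA _ (fun s t => mu s * (nu t * \sum_u rho u * (A (s, t, u))%:R))) /=.
      by apply: eq_bigr => s _; rewrite mulr_sumr.
    by case=> s t _; rewrite -mulr_sumr mulrA.
  by case.
by case=> y u _; rewrite mulrA; case: (A _); rewrite ?mulr1 ?mulr0.
Qed.

Lemma sum_uniform_law (T : finType) (A : {set T}) : (0 < #|A|)%N ->
  \sum_x uniform_law R A x = 1.
Proof.
move=> A0; rewrite /uniform_law -mulr_suml -natr_sum -big_mkcond sum1_card divff //.
by rewrite pnatr_eq0 -lt0n.
Qed.

(** For an equivariant [K] the event does not depend on the permutation, whose law sums to 1. *)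
Lemma Pr_unlabelled n (K : sgraph n.+1 -> {set 'I_n.+1}) (r : 'I_n.+1) :
  (forall p F, K (relabel p F) = p @: K F) ->
  Pr (product_law (product_law (@rrt_law R n.+1) (uniform_law R (perfect_matchings n.+1)))
        (uniform_law R [set: {perm 'I_n.+1}]))
     (fun '(T, G, p) => p r \in K (relabel p (gunion T G)))
  = Ex 1 n (fun t => \sum_(G : sgraph n.+1) uniform_law R (perfect_matchings n.+1) G
       * (r \in K (gunion (tree_graph n t) G))%:R).
Proof.
move=> Krel; rewrite Pr_product3 -(@rrt_law_tree R n
  (fun T => \sum_(G : sgraph n.+1) uniform_law R (perfect_matchings n.+1) G
     * (r \in K (gunion T G))%:R)); apply: eq_bigr => T _; congr (_ * _).
apply: eq_bigr => G _; congr (_ * _).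
rewrite (eq_bigr (fun p => uniform_law R [set: {perm 'I_n.+1}] p
   * (r \in K (gunion T G))%:R)) => [|p _].
  by rewrite -mulr_suml sum_uniform_law ?mul1r // cardsT; apply/card_gt0P; exists 1%g.
by rewrite /= Krel mem_imset //; exact: perm_inj.
Qed.

Lemma confidence_set_relabel n a d1 d2 M p (F : sgraph n) :
  confidence_set a d1 d2 M (relabel p F) = p @: confidence_set a d1 d2 M F.
Proof.
rewrite /confidence_set candidates_relabel card_imset; last exact: perm_inj.
by case: ifP => // _; rewrite imset0.
Qed.

Lemma card_confidence_set n a d1 d2 M (F : sgraph n) :
  (#|confidence_set a d1 d2 M F| <= M)%N.
Proof. by rewrite /confidence_set; case: ifP; rewrite ?cards0. Qed.

(** Expectations in [success_ge] with b = beta * 2^(23 p), of the order of sqrt n. The constants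
    [C1], [C2], [beta], [L], [c] control one error each; the other terms vanish as [p] grows. *)
Lemma success_rate n p L c C1 C2 (beta : R) (a := (2 * L * C1)%N)
    (m := (L * c)%N) (M := (16 * L ^ 2 * a ^ 2 * C2)%N)
    (d1 := (20 * p)%N) (d2 := (45 * p)%N) :
  ~~ odd n.+1 -> (0 < n)%N -> (0 < L)%N -> (0 < c)%N -> (0 < C1)%N -> (0 < C2)%N ->
  0 < beta -> (1 < m)%N -> (m <= p)%N -> (4 * L < p)%N ->
  (2 ^ (46 * p) <= n.+1)%N -> (n.+1 <= 2 ^ (46 * p + 46))%N ->
  1 - (4 / C1%:R + 220 / C2%:R
       + (4 * 2 ^+ 46 + 282 * 2 ^+ 46 * (3 / 2) ^+ 4) / beta * (p.+1%:R * (4 / 5) ^+ p)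
       + 2 * beta ^+ 2
       + 470 * (21 / 10) ^+ 2 * (4 * L%:R * a%:R) * (p.+1%:R * (23 / 25) ^+ p)
       + 2 * (L%:R^-1 + 4 * (c%:R^-1
            + (L%:R ^+ 2 + L%:R * (1 + 2 * m%:R)) * (p.+1%:R * (1 / 2) ^+ p))))
  <= Ex 1 n (fun t => \sum_(G : sgraph n.+1) uniform_law R (perfect_matchings n.+1) G
       * (ord0 \in confidence_set a d1 d2 M (gunion (tree_graph n t) G))%:R).
Proof.
move=> n_even n0 L0 c0 C10 C20 b0 m1 mp Lp Nlow Nhigh.
have p0 : (0 < p)%N by lia.
pose N : R := n.+1%:R; pose lam := N / 2 ^+ d2.
pose b := beta * 2 ^+ (23 * p).
have N0 : 0 < N by rewrite ltr0n.
have two k : 0 < 2 ^+ k :> R by rewrite exprn_gt0.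
have LR : 0 < L%:R :> R by rewrite ltr0n.
have cR : 0 < c%:R :> R by rewrite ltr0n.
have lamp : 2 ^+ p <= lam by apply: lam_ge.
have lam0 : 0 < lam by apply: lt_le_trans lamp.
have aR : 0 < a%:R :> R by rewrite ltr0n /a; lia.
have lamL : 4 * L%:R < lam.
  apply: lt_le_trans lamp; rewrite -natrM -natrX ltr_nat.
  by apply: ltn_trans Lp _; apply: ltn_expl.
have PM0 := perfect_matching_exists n_even.
have d12 : (d1 <= d2)%N by rewrite /d1 /d2; lia.
have b_gt0 : 0 < b by rewrite mulr_gt0.
have Npm : (m <= n.+1)%N.
  apply: leq_trans Nlow; apply: leq_trans mp _; apply: leq_trans (ltnW (ltn_expl p (isT : 1 < 2)%N)) _.
  by rewrite leq_exp2l //; lia.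
pose bad1 := fun t : seq nat => (C1%:R * lam)^-1 * countge R (d2 - 2) t.
pose bad2 := fun t : seq nat => (C2%:R * lam ^+ 2)^-1
  * (\sum_(v < 1 + size t) weight R (d2 - 2) t v ^+ 2).
pose bad3 := fun t : seq nat =>
  b^-1 * (countge R (d2 - 2) t + 2 * hubpairs R (d1 - 2) t).
pose bad4 := fun t : seq nat => (lam / (4 * L%:R * a%:R))^-1 * poorpairs R (d2 - 2) d1 t.
pose bad5 := fun t : seq nat => (inside R d2 t < lam / (2 * L%:R))%R%:R : R.
pose bad6 := fun t : seq nat => (outside R d2 t < lam / (2 * L%:R))%R%:R : R.
apply: (@le_trans _ _ (Ex 1 n (fun t => 1 - (bad1 t + bad2 t + bad3 t + b ^+ 2 / n%:R
    + bad4 t + bad5 t + bad6 t)))); last first.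
  apply: Ex_le => t vt tn.
  apply: le_trans (success_ge vt tn n0 d12 PM0 L0 C10 C20 lamL b_gt0).
  rewrite lerB // /bad1 /bad2 /bad3 /bad4 mulrC.
  by rewrite [(C2%:R * _)^-1 * _]mulrC [b^-1 * _]mulrC [(lam / _)^-1 * _]mulrC.
rewrite ExB Ex_cst // !ExD Ex_cst // lerD2l lerN2.
have h1 : Ex 1 n bad1 <= 4 / C1%:R.
  rewrite ExZ invfM -mulrA mulrC ler_pM2r ?invr_gt0 ?ltr0n //.
  by rewrite mulrC ler_pdivrMr // E_near.
have h2 : Ex 1 n bad2 <= 220 / C2%:R.
  rewrite ExZ invfM -mulrA mulrC ler_pM2r ?invr_gt0 ?ltr0n //.
  by rewrite mulrC ler_pdivrMr ?exprn_gt0 // E_weights.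
have h3 : Ex 1 n bad3 <= (4 * 2 ^+ 46 + 282 * 2 ^+ 46 * (3 / 2) ^+ 4) / beta
    * (p.+1%:R * (4 / 5) ^+ p).
  rewrite ExZ ExD ExZ /b invfM -[leLHS]mulrA [leRHS]mulrAC [leRHS]mulrC.
  rewrite ler_pM2l ?invr_gt0 // [leLHS]mulrC.
  exact: (E_hubs R p0 n0 Nlow Nhigh).
have h4 : Ex 1 n bad4 <= 470 * (21 / 10) ^+ 2 * (4 * L%:R * a%:R) * (p.+1%:R * (23 / 25) ^+ p).
  rewrite ExZ mulrC; apply: E_poor => //; rewrite !mulr_gt0 //.
have hb : b ^+ 2 / n%:R <= 2 * beta ^+ 2.
  rewrite ler_pdivrMr ?ltr0n // /b exprMn -exprM [leRHS]mulrAC [leRHS]mulrC ler_pM2l ?exprn_gt0 //.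
  apply: (@le_trans _ _ N).
    have -> : (23 * p * 2 = 46 * p)%N by rewrite mulnAC.
    by rewrite -natrX ler_nat.
  by rewrite -natrM ler_nat mul2n -addnn -addn1 leq_add2l.
have small : p.+1%:R * (1 / 2) ^+ p >= lam^-1.
  rewrite mul1r exprVn; apply: (@le_trans _ _ (2 ^+ p)^-1).
    by rewrite lef_pV2 ?posrE.
  by rewrite ler_peMl ?ler1n // invr_ge0 ltW.
set s := p.+1%:R * (1 / 2) ^+ p in small *.
have NV : N^-1 <= s.
  apply: le_trans small; rewrite lef_pV2 ?posrE // /lam ler_pdivrMr //.
  by rewrite ler_peMr ?exprn_ege1 ?ler1n // ltW.
have nE : (m.-1 + (n.+1 - m) = n)%N by clear -m1 Npm; lia.
have mE : (m + (n.+1 - m) = n.+1)%N by rewrite subnKC.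
have [h5 h6] := @E_two_sides R d2 L c (n.+1 - m) L0 m1.
move: h5 h6; rewrite -/m nE mE -/N -/lam => h5 h6.
have tail : L%:R^-1 + 4 * (L%:R / m%:R + L%:R ^+ 2 / N + L%:R * (1 + 2 * m%:R) / lam)
    <= L%:R^-1 + 4 * (c%:R^-1 + (L%:R ^+ 2 + L%:R * (1 + 2 * m%:R)) * s).
  rewrite lerD2l ler_pM2l // [leRHS](_ : _ = c%:R^-1 + L%:R ^+ 2 * s + L%:R * (1 + 2 * m%:R) * s); last by ring.
  apply: lerD; first apply: lerD.
  - by rewrite /m natrM invfM mulrA divff ?mul1r // lt0r_neq0.
  - by apply: ler_wpM2l; rewrite ?exprn_ge0.
  - by apply: ler_wpM2l; rewrite // mulr_ge0 // addr_ge0 // mulr_ge0.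
have {}h5 := le_trans h5 tail; have {}h6 := le_trans h6 tail.
rewrite [2 * (L%:R^-1 + _)]mulr_natl mulr2n [leRHS]addrA.
by do 6! apply: lerD => //.
Qed.

End Conclusion.

Lemma Pr_unlabelled_setT (R : realType) n (r : 'I_n.+1) : ~~ odd n.+1 ->
  Pr (product_law (product_law (@rrt_law R n.+1) (uniform_law R (perfect_matchings n.+1)))
        (uniform_law R [set: {perm 'I_n.+1}]))
     (fun '(T, G, p) => p r \in (fun _ : sgraph n.+1 => setT) (relabel p (gunion T G))) = 1.
Proof.
move=> n_even; rewrite Pr_unlabelled => [|p F]; last first.
  by apply/setP => x; rewrite inE -[x](permKV p) imset_f.
rewrite -[RHS](@Ex_cst R 1 n) //; apply: eq_Ex => t _ _.
under eq_bigr => G _ do rewrite inE mulr1.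
exact/sum_uniform_law/perfect_matching_exists.
Qed.

Lemma success_asymptotics (R : realType) (eps : R) : 0 < eps ->
  exists p0 a M : nat, forall n p, ~~ odd n.+1 -> (p0 <= p)%N ->
    (2 ^ (46 * p) <= n.+1)%N -> (n.+1 <= 2 ^ (46 * p + 46))%N ->
    1 - eps <= Ex 1 n (fun t =>
      \sum_(G : sgraph n.+1) uniform_law R (perfect_matchings n.+1) G
       * (ord0 \in confidence_set a (20 * p) (45 * p) M (gunion (tree_graph n t) G))%:R).
Proof.
(* There are eight error terms, each made at most [e]. The constants are fixed before [p0], since
   they enter the decaying terms. *)
move=> eps0; pose e := eps / 10; have e0 : 0 < e by rewrite divr_gt0.
have inv_small (x : R) : 0 <= x -> exists2 k : nat, (1 < k)%N & x / k%:R <= e.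
  move=> x0; exists (Num.bound (x / e)).+2 => //.
  have xe : 0 <= x / e by rewrite divr_ge0 // ltW.
  rewrite ler_pdivrMr // mulrC -ler_pdivrMr // (le_trans (ltW (archi_boundP xe))) // ler_nat.
  by rewrite leqW.
have [C1 C1gt C1e] := inv_small 4 ltac:(done).
have [C2 C2gt C2e] := inv_small 220 ltac:(done).
have [L Lgt Le] := inv_small 2 ltac:(done).
have [c cgt ce] := inv_small 8 ltac:(done).
pose beta := Num.min 1 (e / 2).
have b0 : 0 < beta by rewrite lt_min ltr01 divr_gt0.
have be : 2 * beta ^+ 2 <= e.
  have b1 : beta <= 1 by rewrite ge_min lexx.
  have b2 : beta <= e / 2 by rewrite ge_min lexx orbT.
  have := ler_wpM2l (ltW b0) b1; rewrite -expr2; lra.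
pose a := (2 * L * C1)%N; pose m := (L * c)%N.
have [p1 H1] := @geometric_small R ((4 * 2 ^+ 46 + 282 * 2 ^+ 46 * (3 / 2) ^+ 4) / beta)
  (4 / 5) e ltac:(lra) e0.
have [p2 H2] := @geometric_small R (470 * (21 / 10) ^+ 2 * (4 * L%:R * a%:R))
  (23 / 25) e ltac:(lra) e0.
have [p3 H3] := @geometric_small R (8 * (L%:R ^+ 2 + L%:R * (1 + 2 * m%:R)))
  (1 / 2) e ltac:(lra) e0.
exists (p1 + p2 + p3 + m + (4 * L).+1)%N, a, (16 * L ^ 2 * a ^ 2 * C2)%N.
move=> n p n_even pp Nlow Nhigh.
have [p1p p2p p3p mp Lp] : [/\ (p1 <= p)%N, (p2 <= p)%N, (p3 <= p)%N, (m <= p)%N & (4 * L < p)%N].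
  by clear -pp; split; lia.
have n0 : (0 < n)%N by case: (n) n_even.
have m1 : (1 < m)%N by clear -Lgt cgt; rewrite /m; nia.
apply: le_trans (success_rate n_even n0 (ltnW Lgt) (ltnW cgt) (ltnW C1gt) (ltnW C2gt)
  b0 m1 mp Lp Nlow Nhigh).
rewrite lerD2l lerN2 -/a -/m.
have := H1 p p1p; have := H2 p p2p; have := H3 p p3p.
set g3 := p.+1%:R * (1 / 2) ^+ p.
have -> : 2 * (L%:R^-1 + 4 * (c%:R^-1 + (L%:R ^+ 2 + L%:R * (1 + 2 * m%:R)) * g3))
  = 2 / L%:R + 8 / c%:R + 8 * (L%:R ^+ 2 + L%:R * (1 + 2 * m%:R)) * g3 by ring.
move: C1e C2e Le ce be; rewrite /e.
move: (4 / C1%:R) (220 / C2%:R) (2 / L%:R) (8 / c%:R) (2 * beta ^+ 2).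
move: (8 * _ * g3) (_ * _ * (p.+1%:R * (23 / 25) ^+ p)) (_ * (p.+1%:R * (4 / 5) ^+ p)).
clear -eps0 => x1 x2 x3 x4 x5 x6 x7 x8; lra.
Qed.

Theorem theorem1p8 (R : realType) (eps : R) (eps_gt0 : 0 < eps) :
  exists M : nat, (1 <= M)%N /\
    forall (n : nat) (n_ge2 : (2 <= n)%N) (n_even : ~~ odd n),
    exists K : sgraph n -> {set 'I_n},
      (forall F : sgraph n, (#|K F| <= M)%N) /\
      1 - eps <=
        Pr (product_law
              (product_law (@rrt_law R n) (uniform_law R (perfect_matchings n)))
              (uniform_law R [set: {perm 'I_n}]))
           (fun '(T, G, p) =>
              p (Ordinal (ltnW n_ge2)) \in K (relabel p (gunion T G))).
Proof.
have [p0 [a [M HM]]] := success_asymptotics eps_gt0.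
(* The first summand covers the small [n], for which all vertices are returned. *)
exists (2 ^ (46 * p0) + M)%N; split; first by rewrite addn_gt0 expn_gt0.
case=> // n n_ge2 n_even.
have [small|large] := ltnP n.+1 (2 ^ (46 * p0)).
  exists (fun=> setT); split=> [F|].
    by rewrite cardsT card_ord (leq_trans (ltnW small)) // leq_addr.
  by rewrite Pr_unlabelled_setT // gerBl ltW.
(* The largest [p] with 2^(46 p) at most the number of vertices, now [n.+1]. *)
pose p := (trunc_log 2 n.+1 %/ 46)%N.
exists (confidence_set a (20 * p) (45 * p) M); split=> [F|].
  by rewrite (leq_trans (card_confidence_set _ _ _ _ _)) // leq_addl.
rewrite Pr_unlabelled => [|q F]; last exact: confidence_set_relabel.
rewrite (_ : Ordinal _ = ord0); last exact: val_inj.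
have p0p : (p0 <= p)%N.
  by rewrite leq_divRL // mulnC; apply: trunc_log_max.
apply: HM => //.
  by apply: leq_trans (trunc_logP (isT : 1 < 2)%N (isT : 0 < n.+1)%N);
    rewrite leq_exp2l // mulnC leq_trunc_div.
apply: leq_trans (ltnW (trunc_log_ltn n.+1 (isT : 1 < 2)%N)) _.
by rewrite leq_exp2l // -mulnSr mulnC ltn_ceil.
Qed.
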